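(* Build a real $M\times N$ frame $\Psi=[\psi_1\cdots\psi_N]$ by drawing entries independently at random from a Gaussian distribution of zero mean and unit variance. Next, construct a normalized Gaussian frame $\Phi=[\varphi_1\cdots\varphi_N]$ by taking $\varphi_n:=\frac{\psi_n}{\|\psi_n\|}$ for every $n=1,\dots,N$. Provided $60\log N\le M\le\frac{N-1}{4\log N}$, the following simultaneously hold with probability exceeding $1-11N^{-1}$: (i) $\mu\le\frac{\sqrt{15\log N}}{\sqrt M-\sqrt{12\log N}}$, (ii) $\nu\le\frac{\sqrt{15\log N}}{M-\sqrt{12M\log N}}$, (iii) $\|\Phi\|_2\le\frac{\sqrt M+\sqrt N+\sqrt{2\log N}}{\sqrt{M-\sqrt{8M\log N}}}$.
   Context: $\log$ is the natural logarithm; $\|\Phi\|_2$ is the spectral norm of $\Phi$. The worst-case coherence of $\Phi$ is $\mu:=\max_{i\ne j}|\langle\varphi_i,\varphi_j\rangle|$ and its average coherence is $\nu:=\max_i\left|\frac1{N-1}\sum_{j\ne i}\langle\varphi_i,\varphi_j\rangle\right|$. *)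

(* Defs.v *)
From HB Require Import structures.
From mathcomp Require Import all_boot all_order all_algebra.
From mathcomp Require Import all_classical all_reals all_analysis.

Set Implicit Arguments.
Unset Strict Implicit.
Unset Printing Implicit Defensive.
Import Order.TTheory GRing.Theory Num.Theory.
Import numFieldNormedType.Exports.

Local Open Scope classical_set_scope.
Local Open Scope ring_scope.

(* The library has no Euclidean structure on real column vectors: its norm on
   matrices, [`|A|], is the entrywise max norm. *)
Definition dotcv (R : realType) (m : nat) (u v : 'cV[R]_m) : R :=
  \sum_(i < m) u i 0 * v i 0.

Definition l2norm (R : realType) (m : nat) (u : 'cV[R]_m) : R :=
  Num.sqrt (dotcv u u).

(* Operator norm from l2 to l2; the set is nonempty and bounded, so [sup] is a
   genuine supremum. *)
Definition spectral_norm (R : realType) (m n : nat) (A : 'M[R]_(m, n)) : R :=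
  sup [set l2norm (A *m x) | x in [set x : 'cV[R]_n | l2norm x <= 1]].

(* The frame vectors are the columns. The default value 0 of the maxima below
   is harmless when n > 1, the terms being nonnegative. *)
Definition worst_case_coherence (R : realType) (m n : nat)
    (F : 'M[R]_(m, n)) : R :=
  \big[Num.max/0]_(i < n) \big[Num.max/0]_(j < n | j != i)
    `|dotcv (col i F) (col j F)|.

Definition average_coherence (R : realType) (m n : nat)
    (F : 'M[R]_(m, n)) : R :=
  \big[Num.max/0]_(i < n)
    `|(n%:R - 1)^-1 * \sum_(j < n | j != i) dotcv (col i F) (col j F)|.

(* As x / 0 = 0, a zero column is left unchanged. *)
Definition normalize_cols (R : realType) (m n : nat)
    (F : 'M[R]_(m, n)) : 'M[R]_(m, n) :=
  \matrix_(i < m, j < n) (F i j / l2norm (col j F)).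

Definition mutually_independent (d : measure_display) (T : measurableType d)
    (R : realType) (P : probability T R) (I : finType)
    (X : I -> {RV P >-> R}) : Prop :=
  forall (J : {set I}) (B : I -> set R), (forall i, measurable (B i)) ->
    P (\bigcap_(i in [set` J]) (X i @^-1` B i)) =
    (\prod_(i in J) P (X i @^-1` B i))%E.

(* Equality of laws is required on measurable sets only. The second parameter
   of [normal_prob] is the standard deviation. *)
Definition standard_gaussian (d : measure_display) (T : measurableType d)
    (R : realType) (P : probability T R) (X : {RV P >-> R}) : Prop :=
  forall B : set R, measurable B -> distribution P X B = normal_prob 0 1 B.

Definition random_matrix (d : measure_display) (T : measurableType d)
    (R : realType) (P : probability T R) (m n : nat)
    (X : 'I_m * 'I_n -> {RV P >-> R}) (w : T) : 'M[R]_(m, n) :=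
  \matrix_(i < m, j < n) X (i, j) w.

(* Main.v *)
Require Import Defs.
From HB Require Import structures.
From mathcomp Require Import all_boot all_order all_algebra.
From mathcomp Require Import all_classical all_reals all_analysis.
From mathcomp Require Import measurable_realfun.
From mathcomp Require Import ring lra.

Set Implicit Arguments.
Unset Strict Implicit.
Unset Printing Implicit Defensive.
Import Order.TTheory GRing.Theory Num.Theory.
Import numFieldNormedType.Exports.

Local Open Scope classical_set_scope.
Local Open Scope ring_scope.

(** Write L for log N. The three bounds hold as soon as the Gaussian matrix
    avoids five bad events, whose probabilities add up to at most 7/N.

    Small columns. The squared norm of a column is a chi-square variable, and
    the exponential moment of a Gaussian vector gives
    P(chi^2_k < k(1 - z)) <= exp(-k z^2 / 4). With z = sqrt(8L/M) and a union
    bound over the columns, every column satisfies |psi_j|^2 >= M - sqrt(8ML),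
    except with probability 1/N. Applied to three columns at once, with the
    smaller z = 2.31 sqrt(L/M), the same bound shows that at most two columns
    have |psi_j|^2 < M - 2.31 sqrt(ML), again except with probability 1/N.

    Worst-case coherence. E exp(l <g, g'>) = (1 - l^2)^(-M/2) for independent
    standard Gaussian vectors, so that |<psi_i, psi_j>| <= sqrt(15ML) for all
    pairs; dividing by two column norms gives the coherence bound.

    Average coherence. Changing the signs of the columns does not change the
    law of the matrix, hence sum_j <phi_i, phi_j> behaves as a Rademacher sum
    whose coefficients are bounded by the worst-case coherence. By Hoeffding's
    inequality it is at most sqrt(4L(N-1)) times that bound, and 4LM <= N - 1
    makes the average smaller than the coherence bound by a factor sqrt M.

    Spectral norm. The norm of the unnormalized matrix is controlled by its
    Householder bidiagonalization: rotating the rows, then the columns, and so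
    on, makes the matrix bidiagonal; each entry is the norm of a fresh Gaussian
    vector of at most N or at most M coordinates, and the norm of a bidiagonal
    matrix is at most the largest diagonal entry plus the largest
    off-diagonal one. Chi-square tails bound the two of them by
    sqrt N + 1.43 sqrt L and sqrt M + 1.48 sqrt L. Their sum exceeds the
    numerator sqrt M + sqrt N + sqrt(2L) of the spectral bound by a multiple of
    sqrt L; this is recovered in the denominator, because all columns but two
    have norms at least h0 = sqrt(M - 2.31 sqrt(ML)), which is larger than the
    denominator h = sqrt(M - sqrt(8ML)), while these two columns contribute at
    most sqrt 2 (1 - h/h0) in Frobenius norm.

    The bidiagonalization is carried out as an induction on [split_bound]
    ([gaussian_split_bound]). It needs that orthogonal changes of coordinates
    preserve the Gaussian law ([isotropic_axis]), which is reduced to planar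
    rotations ([normal_prob_rotation]), and that already exposed entries are
    independent of the other ones ([gaussian_conditional_bound]). The
    numerical comparison ([spectral_trade_off]) uses that the hypotheses
    force L >= 39/4 ([ln_ge_of_frame]). *)

(** * Finite Gaussian families *)

Definition cylinders (R : realType) (I : finType) : set (set (I -> R)) :=
  [set [set x | forall i, B i (x i)] | B in [set B : I -> set R | forall i, measurable (B i)]].

(** Families of reals carry the sigma-algebra generated by boxes: box
    probabilities are what independence gives, and boxes form a pi-system. *)
Definition fam (R : realType) (I : finType) : measurableType _ :=
  g_sigma_algebraType (@cylinders R I).

Section fam.
Context {R : realType} {I : finType}.

Lemma measurable_cylinder (B : I -> set R) : (forall i, measurable (B i)) ->
  measurable ([set x | forall i, B i (x i)] : set (fam R I)).
Proof. by move=> mB; apply: sub_sigma_algebra; exists B. Qed.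

Lemma measurable_coord (i : I) : measurable_fun setT (fun x : fam R I => x i).
Proof.
move=> _ B mB; rewrite setTI.
pose C j := if j == i then B else setT.
rewrite (_ : _ @^-1` _ = [set x | forall i, C i (x i)]).
  by apply: measurable_cylinder => j; rewrite /C; case: ifP.
apply/seteqP; split=> x /= xB; last by have := xB i; rewrite /C eqxx.
by move=> j; rewrite /C; case: eqVneq => // ->.
Qed.

Lemma measurable_fam d (T : measurableType d) (X : T -> fam R I) :
  (forall i, measurable_fun setT (fun w => X w i)) -> measurable_fun setT X.
Proof.
move=> mX; apply: (@measurability _ _ T (fam R I) setT X (@cylinders R I)) => //.
move=> _ [_ [B /= mB <-] <-]; rewrite setTI.
rewrite (_ : _ @^-1` _ = \bigcap_(i in [set: I]) ((fun w => X w i) @^-1` B i)).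
  apply: fin_bigcap_measurable => // i _.
  by rewrite -[X in measurable X]setTI; exact: mX.
apply/seteqP; split=> w /= H; [by move=> i _; exact: H | by move=> i; exact: H].
Qed.

Lemma fam_measure_unique (m1 m2 : {measure set (fam R I) -> \bar R}) :
  (m1 setT < +oo)%E ->
  (forall B, (forall i, measurable (B i)) ->
     m1 [set x | forall i, B i (x i)] = m2 [set x | forall i, B i (x i)]) ->
  forall A, measurable A -> m1 A = m2 A.
Proof.
move=> m1oo m12 A mA.
have TE : [set: fam R I] = [set x | forall i, setT (x i)] by apply/seteqP; split.
apply: (@measure_unique _ R (fam R I) (@cylinders R I) (fun=> setT) _ _ _ _ m1 m2) => //.
- move=> _ _ [B mB <-] [C mC <-]; exists (fun i => B i `&` C i).
    by move=> i; exact: measurableI.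
  apply/seteqP; split=> x /=; first by move=> H; split=> i; have [] := H i.
  by move=> [HB HC] i; split.
- by move=> _; exists (fun=> setT) => //; rewrite TE.
- by rewrite bigcup_const.
- by move=> _ [B mB <-]; exact: m12.
Qed.

End fam.

Section gaussian_family.
Context {R : realType}.

(** Independent standard normal variables, in the form of a product formula
    for boxes. *)
Definition gaussian_family d (T : measurableType d) (P : probability T R) (I : finType)
    (X : T -> fam R I) : Prop :=
  (forall i, measurable_fun setT (fun w => X w i)) /\
  forall B : I -> set R, (forall i, measurable (B i)) ->
    P [set w | forall i, B i (X w i)] = (\prod_i normal_prob 0 1 (B i))%E.

Lemma gaussian_family_measurable d (T : measurableType d) (P : probability T R)
  (I : finType) (X : T -> fam R I) :
  gaussian_family P X -> measurable_fun setT X.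
Proof. by move=> [mX _]; exact: measurable_fam. Qed.

(** Boxes form a pi-system that generates the sigma-algebra, so the product
    formula determines the law. All invariance properties of Gaussian families
    are used through this lemma: to replace X by X' in a probability, it
    suffices that both are Gaussian families. *)
Lemma eq_gaussian_law d (T : measurableType d) (P : probability T R)
    d' (T' : measurableType d') (P' : probability T' R) (I : finType)
    (X : T -> fam R I) (X' : T' -> fam R I) :
  gaussian_family P X -> gaussian_family P' X' ->
  forall A, measurable A -> P (X @^-1` A) = P' (X' @^-1` A).
Proof.
move=> gX gX' A mA.
have mX := gaussian_family_measurable gX.
have mX' := gaussian_family_measurable gX'.
pose HX := isMeasurableFun.Build _ _ _ _ X mX.
pose HX' := isMeasurableFun.Build _ _ _ _ X' mX'.
pose Y : {RV P >-> fam R I} := HB.pack X HX.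
pose Y' : {RV P' >-> fam R I} := HB.pack X' HX'.
apply: (fam_measure_unique (m1 := distribution P Y) (m2 := distribution P' Y')) => //.
  by rewrite -[X in (X < _)%E]/(P setT) probability_setT ltry.
by move=> B mB; rewrite /distribution /pushforward; exact: etrans (gX.2 B mB) (esym (gX'.2 B mB)).
Qed.

Lemma eq_gaussian_integral d (T : measurableType d) (P : probability T R)
    d' (T' : measurableType d') (P' : probability T' R) (I : finType)
    (X : T -> fam R I) (X' : T' -> fam R I) (f : fam R I -> \bar R) :
  gaussian_family P X -> gaussian_family P' X' ->
  measurable_fun setT f -> (forall x, 0 <= f x)%E ->
  (\int[P]_w f (X w) = \int[P']_w f (X' w))%E.
Proof.
move=> gX gX' mf f0.
have mX := gaussian_family_measurable gX.
have mX' := gaussian_family_measurable gX'.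
rewrite -(@ge0_integral_pushforward _ _ _ _ _ X mX P setT)//.
rewrite -(@ge0_integral_pushforward _ _ _ _ _ X' mX' P' setT)//.
apply: eq_measure_integral => A mA _.
exact: eq_gaussian_law gX gX' _ mA.
Qed.

Lemma gaussian_reindex d (T : measurableType d) (P : probability T R) (I J : finType)
    (s : J -> I) (X : T -> fam R I) : injective s ->
  gaussian_family P X -> gaussian_family P (fun w j => X w (s j)).
Proof.
move=> sI [mX gX]; split=> [j|B mB]; first exact: mX.
pose C i := if [pick j | s j == i] is Some j then B j else setT.
have CE j : C (s j) = B j.
  by rewrite /C; case: pickP => [k /eqP/sI->//|/(_ j)]; rewrite eqxx.
have CT i : i \notin s @: [set: J]%SET -> C i = setT.
  rewrite /C; case: pickP => [k /eqP <-|//].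
  by rewrite imset_f// inE.
rewrite (_ : [set w | _] = [set w | forall i, C i (X w i)]).
  rewrite gX; last by move=> i; rewrite /C; case: pickP.
  rewrite (bigID (mem (s @: [set: J]%SET)))/= [X in (_ * X)%E]big1 ?mule1; last first.
    by move=> i /CT ->; rewrite probability_setT.
  rewrite big_imset/=; last by move=> ? ? _ _; exact: sI.
  by under eq_bigl do rewrite inE; apply: eq_bigr => j _; rewrite CE.
apply/seteqP; split=> w /= H; last by move=> j; have := H (s j); rewrite CE.
move=> i; have [/imsetP[j _ ->]|/CT->//] := boolP (i \in s @: [set: J]%SET).
by rewrite CE.
Qed.

(** Resampling: the coordinates in J are kept and the other ones replaced. *)
Definition merge (I : finType) (J : pred I) (x y : fam R I) : fam R I :=
  fun i => if J i then x i else y i.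

(** Independence of disjoint blocks of coordinates: taking the block J from one
    copy of the family and its complement from an independent copy yields a
    Gaussian family again. *)
Lemma gaussian_merge d (T : measurableType d) (P : probability T R) (I : finType)
    (X : T -> fam R I) (J : pred I) :
  gaussian_family P X ->
  gaussian_family (P \x P)%E (fun w => merge J (X w.1) (X w.2)).
Proof.
move=> [mX gX]; split=> [i|B mB].
  rewrite /merge; case: (J i).
    by apply: (measurableT_comp (mX i)).
  by apply: (measurableT_comp (mX i)).
pose C1 i := if J i then B i else setT.
pose C2 i := if J i then setT else B i.
have mC1 i : measurable (C1 i) by rewrite /C1; case: ifP.
have mC2 i : measurable (C2 i) by rewrite /C2; case: ifP.
have mP (C : I -> set R) : (forall i, measurable (C i)) -> measurable [set w | forall i, C i (X w i)].
  move=> mC; rewrite -[X in measurable X]setTI.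
  exact: (gaussian_family_measurable (conj mX gX) measurableT (measurable_cylinder mC)).
rewrite (_ : [set w | _] = [set w | forall i, C1 i (X w i)] `*` [set w | forall i, C2 i (X w i)]).
  rewrite /= product_measure1E; [|exact: mP|exact: mP].
  apply: (etrans (congr2 mule (gX _ mC1) (gX _ mC2))).
  rewrite -big_split/=.
  apply: eq_bigr => i _; rewrite /C1 /C2; case: (J i); rewrite probability_setT ?mule1 ?mul1e//.
apply/seteqP; split=> -[w w'] /=.
  by move=> H; split=> i; have := H i; rewrite /merge /C1 /C2; case: (J i).
move=> [H1 H2] i; have := H1 i; have := H2 i.
by rewrite /merge /C1 /C2; case: (J i).
Qed.

Lemma gaussian_integral_mul d (T : measurableType d) (P : probability T R) (I : finType)
    (X : T -> fam R I) (J : pred I) (f g : fam R I -> \bar R) :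
  gaussian_family P X ->
  measurable_fun setT f -> measurable_fun setT g ->
  (forall x, 0 <= f x)%E -> (forall x, 0 <= g x)%E ->
  (forall x y, {in J, x =1 y} -> f x = f y) ->
  (forall x y, {in predC J, x =1 y} -> g x = g y) ->
  (\int[P]_w (f (X w) * g (X w)) = (\int[P]_w f (X w)) * (\int[P]_w g (X w)))%E.
Proof.
move=> gX mf mg f0 g0 fJ gJ.
have mX := gaussian_family_measurable gX.
have mfX : measurable_fun setT (fun w => f (X w)) by exact: measurableT_comp.
have mgX : measurable_fun setT (fun w => g (X w)) by exact: measurableT_comp.
rewrite (eq_gaussian_integral (f := fun x => f x * g x)%E gX (gaussian_merge J gX)); last 2 first.
- exact: emeasurable_funM.
- by move=> x; exact: mule_ge0.
have -> : (fun w : T * T => f (merge J (X w.1) (X w.2)) * g (merge J (X w.1) (X w.2)))%E =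
   (fun w => f (X w.1) * g (X w.2))%E.
  apply/funext => w; congr (_ * _)%E.
    by apply: fJ => i; rewrite /merge -topredE /= => ->.
  by apply: gJ => i; rewrite /merge -topredE /= => /negbTE ->.
rewrite /= fubini_tonelli1/=; last 2 first.
- by apply: emeasurable_funM; [exact: (measurableT_comp mfX)|exact: (measurableT_comp mgX)].
- by move=> x; exact: mule_ge0.
rewrite /fubini_F/=.
have -> : (\int[P]_w \int[P]_w' (f (X w) * g (X w')) =
    \int[P]_w (f (X w) * \int[P]_w' g (X w')))%E.
  by apply: eq_integral => w _; rewrite ge0_integralZl//.
by rewrite ge0_integralZr// integral_ge0.
Qed.

End gaussian_family.

(** * Rotation invariance of the planar normal law *)
Section normal.
Context {R : realType}.
Local Notation mu := (@lebesgue_measure R).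

Import HBNNSimple.

(** Normal probabilities are defined by a density on sets; simple functions and
    monotone convergence carry this over to integrals. *)
Lemma ge0_integral_normal_prob (m s : R) (f : R -> \bar R) :
  measurable_fun setT f -> (forall x, 0 <= f x)%E ->
  (\int[normal_prob m s]_x f x = \int[mu]_x (f x * (normal_pdf m s x)%:E))%E.
Proof.
move=> mf f0.
have mp : measurable_fun setT (fun x : R => (normal_pdf m s x)%:E).
  by apply/measurable_EFinP; exact: measurable_normal_pdf.
have p0 x : (0 <= (normal_pdf m s x)%:E)%E by rewrite lee_fin normal_pdf_ge0.
have setE E : measurable E -> (\int[normal_prob m s]_x (\1_E x)%:E =
    \int[mu]_x ((\1_E x)%:E * (normal_pdf m s x)%:E))%E.
  move=> mE; rewrite integral_indic//= setIT /normal_prob integral_mkcond.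
  apply: eq_integral => x _; rewrite patchE indicE.
  by case: (x \in E); rewrite ?mul1e ?mul0e.
have nnE (g : {nnsfun R >-> R}) : (\int[normal_prob m s]_x (g x)%:E =
    \int[mu]_x ((g x)%:E * (normal_pdf m s x)%:E))%E.
  have mg r : measurable (g @^-1` [set r]).
    rewrite -[X in measurable X]setTI.
    by apply: (measurable_funPT g).
  under [LHS]eq_integral do rewrite fimfunE -fsumEFin//.
  rewrite [LHS]ge0_integral_fsum//; last 2 first.
  - by move=> r; apply/measurable_EFinP; apply: measurable_funM => //; apply: measurable_indic; exact: mg.
  - by move=> n x _; rewrite EFinM nnfun_muleindic_ge0.
  have gE x : ((g x)%:E * (normal_pdf m s x)%:E = \sum_(r \in range g)
      ((r * \1_(g @^-1` [set r]) x)%:E * (normal_pdf m s x)%:E))%E.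
    rewrite {1}fimfunE -fsumEFin// ge0_mule_fsuml// => r.
    by rewrite EFinM nnfun_muleindic_ge0.
  under [RHS]eq_integral do rewrite gE.
  rewrite [RHS]ge0_integral_fsum//; last 2 first.
  - move=> r; apply: emeasurable_funM => //.
    by apply/measurable_EFinP; apply: measurable_funM => //; apply: measurable_indic; exact: mg.
  - by move=> n x _; apply: mule_ge0 => //; rewrite EFinM nnfun_muleindic_ge0.
  apply: eq_fsbigr => r rg.
  have r0 : (0 <= r)%R by move: rg; rewrite inE/= => -[x _ <-].
  under [LHS]eq_integral do rewrite EFinM.
  under [RHS]eq_integral do rewrite EFinM -muleA.
  have mi : measurable_fun setT (fun x : R => (\1_(g @^-1` [set r]) x : R)%:E).
    by apply/measurable_EFinP; apply: measurable_indic; exact: mg.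
  rewrite [LHS]ge0_integralZl//.
  rewrite [RHS]ge0_integralZl//; last 2 first.
  - exact: emeasurable_funM.
  - by move=> x _; apply: mule_ge0 => //; rewrite lee_fin.
  by congr (_ * _)%E; exact: setE (mg r).
pose f_ := nnsfun_approx measurableT mf.
have ndf i j x : (i <= j)%N -> f_ i x <= f_ j x.
  by move=> ij; have /lefP := nd_nnsfun_approx measurableT mf ij; apply.
transitivity (lim (\int[normal_prob m s]_x (f_ n x)%:E @[n --> \oo])%E).
  rewrite -monotone_convergence//=.
  - apply: eq_integral => ? /[!inE] xD; apply/esym/cvg_lim => //=.
    exact: cvg_nnsfun_approx.
  - by move=> n; apply/measurable_EFinP; exact: (measurable_funPT (f_ n)).
  - by move=> n ? _; rewrite lee_fin.
  - by move=> ? _ ? ? mn; rewrite lee_fin; exact: ndf.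
transitivity (lim (\int[mu]_x ((f_ n x)%:E * (normal_pdf m s x)%:E) @[n --> \oo])%E).
  by apply: congr_lim; apply/funext => n /=; exact: nnE.
rewrite -monotone_convergence//=; last 3 first.
- move=> n; apply: emeasurable_funM => //.
  by apply/measurable_EFinP; exact: (measurable_funPT (f_ n)).
- by move=> n x _; apply: mule_ge0 => //; rewrite lee_fin.
- move=> x _ i j ij; apply: lee_wpmul2r => //; rewrite lee_fin.
  exact: ndf.
apply: eq_integral => x _.
apply/cvg_lim => //; apply: cvgeZr => //.
exact: cvg_nnsfun_approx.
Qed.

(** Both sides are measures that agree on bounded intervals. *)
Lemma lebesgue_measure_affine (a b : R) (A : set R) : a != 0 -> measurable A ->
  (mu A = `|a|%:E * mu ((fun x => a * x + b)%R @^-1` A))%E.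
Proof.
move=> a0 mA.
have mphi : measurable_fun setT (fun x : measurableTypeR R => (a * x + b : measurableTypeR R)%R).
  by apply: measurable_funD => //; apply: measurable_funM.
have na : 0 <= `|a| by [].
pose m' : {measure set (measurableTypeR R) -> \bar R} :=
  mscale (NngNum na) (measure_function_pushforward__canonical__measure_function_Measure mu mphi).
rewrite -[RHS]/(m' A); apply: lebesgue_measure_unique => // _ [[x y] _ <-].
rewrite -[RHS]/(`|a|%:E * mu ((fun z => a * z + b)%R @^-1` `]x, y]))%E.
rewrite [LHS]lebesgue_measure_itv/=.
have [a_gt0|a_lt0] := boolP (0 < a).
  rewrite (_ : _ @^-1` _ = `](x - b) / a, (y - b) / a]%classic); last first.
    apply/seteqP; split=> z /=; rewrite !in_itv/= ltr_pdivrMr// ler_pdivlMr//;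
      by rewrite (mulrC z) ltrBlDr lerBrDr.
  rewrite lebesgue_measure_itv/= !lte_fin ltr_pM2r ?invr_gt0// ltrD2r.
  case: ifP => _; last by rewrite mule0.
  by rewrite -!EFinD -EFinM gtr0_norm//; congr EFin; field.
have {}a_lt0 : a < 0 by rewrite lt_neqAle a0 leNgt.
rewrite (_ : _ @^-1` _ = `[(y - b) / a, (x - b) / a[%classic); last first.
  apply/seteqP; split=> z /=; rewrite !in_itv/= ltr_ndivlMr// ler_ndivrMr//;
    by rewrite (mulrC z) ltrBlDr lerBrDr andbC.
rewrite lebesgue_measure_itv/= !lte_fin ltr_nM2r ?invr_lt0// ltrD2r.
case: ifP => _; last by rewrite mule0.
by rewrite -!EFinD -EFinM ltr0_norm//; congr EFin; field.
Qed.

Lemma ge0_integral_affine (a b : R) (f : R -> \bar R) : a != 0 ->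
  measurable_fun setT f -> (forall x, 0 <= f x)%E ->
  (\int[mu]_x f x = `|a|%:E * \int[mu]_x f (a * x + b)%R)%E.
Proof.
move=> a0 mf f0.
have mphi : measurable_fun setT (fun x : measurableTypeR R => (a * x + b : measurableTypeR R)%R).
  by apply: measurable_funD => //; apply: measurable_funM.
have na : 0 <= `|a| by [].
pose m' : {measure set (measurableTypeR R) -> \bar R} :=
  mscale (NngNum na) (measure_function_pushforward__canonical__measure_function_Measure mu mphi).
transitivity (\int[m']_x f x)%E.
  by apply: eq_measure_integral => A mA _; exact: lebesgue_measure_affine.
rewrite ge0_integral_mscale//=; congr (_ * _)%E.
by rewrite (ge0_integral_pushforward mphi).
Qed.

End normal.

Section rotation.
Context {R : realType}.
Local Notation mu := (@lebesgue_measure R).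
Local Notation gamma := (normal_prob (0 : R) 1).

Let g (x : R) := normal_pdf 0 1 x.

Lemma normal_pdf_rotation (c s x y : R) : c ^+ 2 + s ^+ 2 = 1 ->
  normal_pdf 0 1 (c * x + s * y) * normal_pdf 0 1 (c * y - s * x) =
  normal_pdf 0 1 x * normal_pdf 0 1 y.
Proof.
move=> cs; rewrite !normal_pdfE ?oner_neq0// /normal_fun !subr0.
rewrite mulrACA [in RHS]mulrACA -!expRD; congr (_ * expR _).
rewrite -!mulrDl -!opprD; congr (- _ / _).
transitivity ((c ^+ 2 + s ^+ 2) * (x ^+ 2 + y ^+ 2)); first by ring.
by rewrite cs mul1r.
Qed.

Lemma normal_prob_indicE (A : set R) : measurable A ->
  (gamma A = \int[mu]_x ((\1_A x)%:E * (normal_pdf 0 1 x)%:E))%E.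
Proof.
move=> mA; rewrite -ge0_integral_normal_prob//; last first.
  by apply/measurable_EFinP; exact: measurable_indic.
by rewrite integral_indic// setIT.
Qed.

Lemma normal_probN (A : set R) : measurable A -> gamma (-%R @^-1` A) = gamma A.
Proof.
move=> mA.
have mNA : measurable (-%R @^-1` A).
  by rewrite -[X in measurable X]setTI; exact: (@oppr_measurable R setT).
rewrite !normal_prob_indicE//.
rewrite [RHS](@ge0_integral_affine _ (-1) 0)//; last 2 first.
- apply: emeasurable_funM; apply/measurable_EFinP.
    exact: measurable_indic.
  exact: measurable_normal_pdf.
- by move=> x; apply: mule_ge0; rewrite lee_fin// normal_pdf_ge0.
rewrite normrN1 mul1e; apply: eq_integral => x _.
rewrite mulN1r addr0 !normal_pdfE ?oner_neq0// /normal_fun !subr0 sqrrN.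
by rewrite !indicE.
Qed.

(** The density of the planar normal law only depends on x^2 + y^2, so the
    claim is the invariance of the plane Lebesgue measure under a rotation. For
    c != 0 the rotation factors into two shears with a scaling; each of them
    changes one variable at a time, which Tonelli's theorem reduces to an affine
    substitution on the line. For c = 0 the rotation is an exchange of the axes
    with a change of sign. *)
Lemma normal_prob_rotation (c s : R) (A B : set R) : c ^+ 2 + s ^+ 2 = 1 ->
  measurable A -> measurable B ->
  ((gamma \x gamma) [set w : R * R | A (c * w.1 + s * w.2)%R /\ B (c * w.2 - s * w.1)%R]
  = gamma A * gamma B)%E.
Proof.
move=> cs mA mB.
have [c0|c0] := eqVneq c 0.
  have : s ^+ 2 == 1 by rewrite -cs c0 expr0n/= add0r.
  rewrite sqrf_eq1 => /orP[]/eqP sE.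
    rewrite (_ : [set w | _] = (-%R @^-1` B) `*` A).
      rewrite product_measure1E//; last first.
        by rewrite -[X in measurable X]setTI; exact: (@oppr_measurable R setT).
      by rewrite [X in (X * _)%E]normal_probN// muleC.
    by apply/seteqP; split=> -[x y]/=; rewrite c0 sE !mul0r !mul1r !add0r => -[].
  rewrite (_ : [set w | _] = B `*` (-%R @^-1` A)).
    rewrite product_measure1E//; last first.
      by rewrite -[X in measurable X]setTI; exact: (@oppr_measurable R setT).
    by rewrite [X in (_ * X)%E]normal_probN// muleC.
  by apply/seteqP; split=> -[x y]/=; rewrite c0 sE !mul0r !mulN1r !add0r opprK => -[].
pose F (w : R * R) : \bar R := ((\1_A w.1 * \1_B w.2)%:E * (g w.1 * g w.2)%:E)%E.
have F0 w : (0 <= F w)%E.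
  by rewrite /F -EFinM lee_fin !mulr_ge0// ?normal_pdf_ge0.
have mg : measurable_fun setT g by exact: measurable_normal_pdf.
have mi D : measurable D -> measurable_fun setT (\1_D : R -> R).
  by move=> mD; exact: measurable_indic.
have mF : measurable_fun [set: R * R] F.
  apply: emeasurable_funM; apply/measurable_EFinP; apply: measurable_funM.
  - exact: (measurableT_comp (mi _ mA)).
  - exact: (measurableT_comp (mi _ mB)).
  - exact: (measurableT_comp mg).
  - exact: (measurableT_comp mg).
have mrot : measurable_fun [set: R * R] (fun w : R * R => (c * w.1 + s * w.2, c * w.2 - s * w.1)).
  apply: measurable_fun_pair.
    by apply: measurable_funD; apply: measurable_funM => //.
  by apply: measurable_funB; apply: measurable_funM => //.
have mE : measurable [set w : R * R | A (c * w.1 + s * w.2) /\ B (c * w.2 - s * w.1)].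
  rewrite (_ : [set w | _] = (fun w : R * R => (c * w.1 + s * w.2, c * w.2 - s * w.1)) @^-1` (A `*` B))//.
  rewrite -[X in measurable X]setTI; apply: mrot => //.
  exact: measurableX.
have mFrot : measurable_fun [set: R * R] (fun w => F (c * w.1 + s * w.2, c * w.2 - s * w.1)).
  exact: (measurableT_comp mF).
transitivity (\int[mu]_x \int[mu]_y F (c * x + s * y, c * y - s * x)%R)%E.
  rewrite /product_measure1 ge0_integral_normal_prob; last 2 first.
  - exact: measurable_fun_xsection.
  - by [].
  apply: eq_integral => x _.
  rewrite muleC /= {1}/normal_prob integral_mkcond -ge0_integralZl//; last 3 first.
  - apply/(measurable_restrict _ _ _) => //.
      exact: measurable_xsection.
    apply: measurable_funTS; apply/measurable_EFinP; exact: mg.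
  - move=> y _; rewrite patchE; case: ifP => // _; rewrite lee_fin; exact: normal_pdf_ge0.
  - by rewrite lee_fin normal_pdf_ge0.
  apply: eq_integral => y _; rewrite patchE /F /=.
  rewrite /g normal_pdf_rotation// mem_xsection.
  rewrite !indicE.
  case: ifPn => [/set_mem[/= Ap Bq]|H].
    by rewrite !mem_set// mul1r mul1e EFinM.
  rewrite mule0.
  have [Ap|Ap] := boolP (_ \in A); last by rewrite mul0r mul0e.
  have [Bq|Bq] := boolP (_ \in B); last by rewrite mulr0 mul0e.
  by case/negP: H; apply/mem_set; split; exact/set_mem.
rewrite (@fubini_tonelli _ _ _ _ R mu mu _ mFrot (fun=> F0 _))/=.
have stepx y : (\int[mu]_x F (c * x + s * y, c * y - s * x)%R =
    `|c|^-1%:E * \int[mu]_p F (p, c^-1 * y + - (s / c * p))%R)%E.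
  rewrite (@ge0_integral_affine _ c (s * y) (fun p => F (p, c^-1 * y + - (s / c * p))%R))//; last first.
    apply: (measurableT_comp mF) => //; apply: measurable_fun_pair => //.
    by apply: measurable_funB => //; exact: measurable_funM.
  rewrite muleA -EFinM mulVf ?normr_eq0// mul1e; apply: eq_integral => x _.
  congr F; congr (_, _).
  transitivity (((c ^+ 2 + s ^+ 2) * y - s * (c * x + s * y)) / c); last by rewrite cs; field.
  by field.
under eq_integral do rewrite stepx.
have mF2 : measurable_fun [set: R * R] (fun w : R * R => F (w.2, c^-1 * w.1 + - (s / c * w.2))).
  apply: (measurableT_comp mF) => //; apply: measurable_fun_pair => //.
  by apply: measurable_funB => //; apply: measurable_funM.
rewrite ge0_integralZl//; last 2 first.
- exact: (measurable_fun_fubini_tonelli_F (m2 := mu) _ mF2 (fun=> F0 _)).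
- by move=> y _; exact: integral_ge0.
rewrite (@fubini_tonelli _ _ _ _ R mu mu _ mF2 (fun=> F0 _))/=.
have stepq p : (\int[mu]_y F (p, c^-1 * y + - (s / c * p))%R = `|c|%:E * \int[mu]_q F (p, q))%E.
  rewrite (@ge0_integral_affine _ c^-1 (- (s / c * p)) (fun q => F (p, q)))//; last 2 first.
  - by rewrite invr_eq0.
  - apply: (measurableT_comp mF) => //.
  by rewrite muleA -EFinM normfV mulfV ?normr_eq0// mul1e.
under eq_integral do rewrite stepq.
rewrite ge0_integralZl//; last 2 first.
- exact: (measurable_fun_fubini_tonelli_F (m2 := mu) _ mF F0).
- by move=> y _; exact: integral_ge0.
rewrite muleA -EFinM mulVf ?normr_eq0// mul1e.
have FE x y : F (x, y) = (((\1_A x)%:E * (g x)%:E) * ((\1_B y)%:E * (g y)%:E))%E.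
  by rewrite /F/= -!EFinM; congr EFin; ring.
have mh D : measurable D -> measurable_fun setT (fun x : R => ((\1_D x)%:E * (g x)%:E)%E).
  by move=> mD; apply: emeasurable_funM; apply/measurable_EFinP; [exact: mi|exact: mg].
have h0 D x : (0 <= (\1_D x)%:E * (g x)%:E)%E.
  by apply: mule_ge0; rewrite lee_fin// normal_pdf_ge0.
have intB x : (\int[mu]_y F (x, y) = (\1_A x)%:E * (g x)%:E * gamma B)%E.
  under eq_integral do rewrite FE.
  by rewrite ge0_integralZl ?(normal_prob_indicE mB)//; exact: mh.
under eq_integral do rewrite intB.
by rewrite ge0_integralZr ?(normal_prob_indicE mA)//; exact: mh.
Qed.

End rotation.

(** * Orthogonal matrices that preserve the Gaussian law *)
Section givens.
Context {R : realType} d (T : measurableType d) (P : probability T R).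
Local Notation gamma := (normal_prob (0 : R) 1).

Lemma gaussian_pair :
  gaussian_family (gamma \x gamma)%E (fun (w : R * R) (b : bool) => if b then w.1 else w.2).
Proof.
split=> [[]|B mB]; [exact: measurable_fst|exact: measurable_snd|].
rewrite (_ : [set w | _] = B true `*` B false); last first.
  apply/seteqP; split=> -[x y]/=; first by move=> H; split; [exact: (H true)|exact: (H false)].
  by move=> [? ?] [].
rewrite [LHS]product_measure1E; [|exact: mB|exact: mB].
by rewrite big_bool.
Qed.

Definition rotate (I : finType) (i j : I) (c s : R) (x : fam R I) : fam R I :=
  fun k => if k == i then c * x i + s * x j
           else if k == j then c * x j - s * x i else x k.

Lemma measurable_rotate (I : finType) (i j : I) c s :
  measurable_fun setT (rotate i j c s).
Proof.
apply: measurable_fam => k; rewrite /rotate.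
case: (k == i); [|case: (k == j); last exact: measurable_coord].
- by apply: measurable_funD; apply: measurable_funM => //; exact: measurable_coord.
- by apply: measurable_funB; apply: measurable_funM => //; exact: measurable_coord.
Qed.

(** The coordinates i and j form a Gaussian pair, independent of the other
    coordinates; [normal_prob_rotation] applies to that pair. *)
Lemma gaussian_rotate (I : finType) (i j : I) (c s : R) (X : T -> fam R I) :
  i != j -> c ^+ 2 + s ^+ 2 = 1 -> gaussian_family P X ->
  gaussian_family P (fun w => rotate i j c s (X w)).
Proof.
move=> ij cs gX; have mX := gaussian_family_measurable gX; split=> [k|B mB].
  exact: (measurableT_comp (measurable_coord k) (measurableT_comp (measurable_rotate i j c s) mX)).
pose J := [pred k | (k == i) || (k == j)].
have mRB : measurable [set x : fam R I | forall k, B k (rotate i j c s x k)].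
  rewrite -[X in measurable X]setTI.
  exact: (measurable_rotate i j c s measurableT (measurable_cylinder mB)).
rewrite (eq_gaussian_law gX (gaussian_merge J gX) mRB).
pose C k := if J k then setT else B k.
have mC k : measurable (C k) by rewrite /C; case: ifP.
pose D := [set w | B i (c * X w i + s * X w j) /\ B j (c * X w j - s * X w i)].
have mR2 : measurable [set x : fam R bool |
    B i (c * x true + s * x false) /\ B j (c * x false - s * x true)].
  rewrite (_ : [set x | _] = ((fun x : fam R bool => c * x true + s * x false) @^-1` B i) `&`
    ((fun x : fam R bool => c * x false - s * x true) @^-1` B j))//.
  apply: measurableI; rewrite -[X in measurable X]setTI.
  - have : measurable_fun setT (fun x : fam R bool => c * x true + s * x false).
      by apply: measurable_funD; apply: measurable_funM => //; exact: measurable_coord.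
    exact.
  - have : measurable_fun setT (fun x : fam R bool => c * x false - s * x true).
      by apply: measurable_funB; apply: measurable_funM => //; exact: measurable_coord.
    exact.
pose h (b : bool) := if b then i else j.
have hI : injective h.
  by move=> [] [] //= E; move: ij; rewrite ?E ?eqxx// -E eqxx.
have gh := gaussian_reindex hI gX.
have PD : P D = (gamma (B i) * gamma (B j))%E.
  rewrite -(normal_prob_rotation cs (mB i) (mB j)).
  exact: (eq_gaussian_law gh gaussian_pair mR2).
have mD : measurable D.
  by have := gaussian_family_measurable gh measurableT mR2; rewrite setTI.
have PC := gX.2 _ mC.
have mCX : measurable [set w | forall k, C k (X w k)].
  by have := mX measurableT _ (measurable_cylinder mC); rewrite setTI.
rewrite (_ : _ @^-1` _ = D `*` [set w | forall k, C k (X w k)]); last first.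
  apply/seteqP; split=> -[w w'] /=.
    move=> H; split.
      have Ji : J i by rewrite /J /= eqxx.
      have Jj : J j by rewrite /J /= eqxx orbT.
      split; first by have := H i; rewrite /rotate /merge eqxx Ji Jj.
      by have := H j; rewrite /rotate /merge eqxx eq_sym (negbTE ij) Ji Jj.
    move=> k; rewrite /C; case: ifPn => //= kJ.
    have := H k; rewrite /rotate /merge [J k]/= (negbTE kJ).
    by move: kJ; rewrite negb_or => /andP[/negbTE -> /negbTE ->].
  have Ji : J i by rewrite /J /= eqxx.
  have Jj : J j by rewrite /J /= eqxx orbT.
  move=> [[Hi Hj] H] k; rewrite /rotate /merge Ji Jj.
  case: eqVneq => [->//|ki]; case: eqVneq => [->//|kj] /=.
  by have := H k; rewrite /C /= (negbTE ki) (negbTE kj).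
rewrite /= product_measure1E//.
apply: (etrans (congr2 mule PD PC)).
rewrite (bigD1 i)//= (bigD1 j)/=; last by rewrite eq_sym.
rewrite [RHS](bigD1 i)//= [X in _ = (_ * X)%E](bigD1 j)/=; last by rewrite eq_sym.
rewrite -muleA; congr (_ * (_ * _))%E.
rewrite /C /= !eqxx !orbT !probability_setT !mul1e.
by apply: eq_bigr => k /andP[ki kj]; rewrite (negbTE ki) (negbTE kj).
Qed.

Definition matrix_of m n (x : fam R ('I_m * 'I_n)%type) : 'M[R]_(m, n) := \matrix_(i, j) x (i, j).

(** Every orthogonal matrix preserves the Gaussian law; here this is a part of
    the definition, because the orthogonal matrices used below are products of
    Givens rotations and the invariance is proved factor by factor. *)
Definition isotropic m (Q : 'M[R]_m) : Prop :=
  (forall v w : 'cV[R]_m, dotcv (Q *m v) (Q *m w) = dotcv v w) /\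
  forall n (X : T -> fam R ('I_m * 'I_n)%type), gaussian_family P X ->
    gaussian_family P (fun w ij => (Q *m matrix_of (X w)) ij.1 ij.2).

Lemma isotropic1 m : isotropic (1%:M : 'M[R]_m).
Proof.
split=> [v w|n X gX]; first by rewrite !mul1mx.
by under eq_fun do under eq_fun do rewrite mul1mx mxE -surjective_pairing.
Qed.

Lemma isotropicM m (Q1 Q2 : 'M[R]_m) : isotropic Q1 -> isotropic Q2 -> isotropic (Q1 *m Q2).
Proof.
move=> [d1 g1] [d2 g2]; split=> [v w|n X gX]; first by rewrite -!mulmxA d1 d2.
have := g1 _ _ (g2 _ _ gX).
under [X in gaussian_family P X -> _]eq_fun => w.
  have -> : matrix_of (fun ij => (Q2 *m matrix_of (X w)) ij.1 ij.2) = Q2 *m matrix_of (X w).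
    by apply/matrixP => i j; rewrite mxE.
  rewrite mulmxA.
  over.
exact.
Qed.

Definition givens m (i j : 'I_m) (c s : R) : 'M[R]_m :=
  \matrix_(a, b) if a == i then c * (b == i)%:R + s * (b == j)%:R
                 else if a == j then c * (b == j)%:R - s * (b == i)%:R
                 else (a == b)%:R.

Lemma givensE m n (i j : 'I_m) c s (G : 'M[R]_(m, n)) a l :
  (givens i j c s *m G) a l =
  if a == i then c * G i l + s * G j l
  else if a == j then c * G j l - s * G i l else G a l.
Proof.
have sel k : \sum_b (b == k)%:R * G b l = G k l.
  rewrite (bigD1 k)//= eqxx mul1r big1 ?addr0// => b /negbTE ->.
  by rewrite mul0r.
rewrite mxE; under eq_bigr do rewrite mxE.
case: ifP => _; [|case: ifP => _].
- under eq_bigr do rewrite mulrDl -!mulrA.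
  by rewrite big_split/= -!mulr_sumr !sel.
- under eq_bigr do rewrite mulrBl -!mulrA.
  by rewrite big_split/= sumrN -!mulr_sumr !sel.
- by under eq_bigr do rewrite eq_sym; rewrite sel.
Qed.

Lemma isotropic_givens m (i j : 'I_m) (c s : R) : i != j -> c ^+ 2 + s ^+ 2 = 1 ->
  isotropic (givens i j c s).
Proof.
move=> ij cs; split=> [v w|n X gX].
  rewrite /dotcv; under eq_bigr do rewrite !givensE.
  rewrite (bigD1 i)//= (bigD1 j)/=; last by rewrite eq_sym.
  rewrite [RHS](bigD1 i)//= [X in _ = _ + X](bigD1 j)/=; last by rewrite eq_sym.
  rewrite !eqxx eq_sym (negbTE ij) !addrA; congr (_ + _); last first.
    by apply: eq_bigr => k /andP[/negbTE -> /negbTE ->].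
  transitivity ((c ^+ 2 + s ^+ 2) * (v i 0 * w i 0 + v j 0 * w j 0)); first by ring.
  by rewrite cs mul1r.
(* the row rotation acts on each column separately: rotate the columns one by one *)
have H k : (k <= n)%N -> gaussian_family P (fun w (ij : 'I_m * 'I_n) => if (ij.2 < k)%N
    then (givens i j c s *m matrix_of (X w)) ij.1 ij.2 else X w ij).
  elim: k => [_|k IH kn]; first exact: gX.
  pose l := Ordinal kn.
  have ijl : (i, l) != (j, l) by rewrite xpair_eqE (negbTE ij).
  have := gaussian_rotate ijl cs (IH (ltnW kn)).
  congr (gaussian_family P _); apply/funext => w; apply/funext => -[a b].
  rewrite /rotate /= ltnn !xpair_eqE !givensE !mxE.
  have [->|bl] := eqVneq b l.
    by rewrite !andbT ltnn ltnS leqnn.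
  rewrite !andbF [(b < k.+1)%N]ltnS [(b <= k)%N]leq_eqVlt.
  have -> : (nat_of_ord b == k) = false; last by [].
  by apply/negbTE; apply: contra bl => /eqP bk; apply/eqP/val_inj.
have := H n (leqnn n).
by congr (gaussian_family P _); apply/funext => w; apply/funext => -[a b] /=; rewrite ltn_ord.
Qed.

(** Givens rotations in the planes (0, 1), (0, 2), and so on successively cancel
    the coordinates of c but the first one. *)
Lemma isotropic_axis m (c : 'cV[R]_m.+1) :
  exists2 Q : 'M[R]_m.+1, isotropic Q & forall i, i != 0 -> (Q *m c) i 0 = 0.
Proof.
suff H k : (k <= m)%N -> exists2 Q : 'M[R]_m.+1, isotropic Q &
    forall i : 'I_m.+1, (0 < i <= k)%N -> (Q *m c) i 0 = 0.
  have [Q iQ Q0] := H m (leqnn m); exists Q => // i i0.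
  by apply: Q0; rewrite lt0n i0 -ltnS ltn_ord.
elim: k => [_|k IH km].
  exists 1%:M; first exact: isotropic1.
  by move=> i; rewrite leqn0 lt0n => /andP[/negbTE ->].
have [Q iQ Q0] := IH (ltnW km).
pose j : 'I_m.+1 := Ordinal (km : (k.+1 < m.+1)%N).
have j0 : 0 != j by [].
pose e := Q *m c.
have [ej|ej] := eqVneq (e j 0) 0.
  exists Q => // i /andP[i0]; rewrite leq_eqVlt => /orP[/eqP ik|ik].
    by rewrite (_ : i = j)//; apply/val_inj.
  by apply: Q0; rewrite i0.
(* The Givens rotation by the angle of (e_0, e_j) cancels the coordinate j. *)
pose r := Num.sqrt (e 0 0 ^+ 2 + e j 0 ^+ 2).
have r2 : 0 < e 0 0 ^+ 2 + e j 0 ^+ 2.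
  by rewrite ltr_wpDl ?sqr_ge0// exprn_even_gt0.
have r0 : r != 0 by rewrite gt_eqF// sqrtr_gt0.
have rr : r ^+ 2 = e 0 0 ^+ 2 + e j 0 ^+ 2 by rewrite sqr_sqrtr// ltW.
exists (givens 0 j (e 0 0 / r) (e j 0 / r) *m Q).
  apply: isotropicM => //; apply: isotropic_givens => //.
  by rewrite !expr_div_n -mulrDl -rr divff// expf_neq0.
move=> i /andP[i0 ik]; rewrite -mulmxA givensE.
case: ifPn => [/eqP iE|_]; first by rewrite iE in i0.
case: ifPn => [/eqP iE|ij]; first by rewrite -/e; field.
apply: Q0; rewrite i0/= -ltnS ltn_neqAle ik andbT.
by apply: contra ij => /eqP ij; apply/eqP/val_inj.
Qed.

End givens.

(** * A bilinear bound stable under peeling off rows *)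
Section rational_vectors.
Context {R : realType}.

(** By continuity it is enough to test rational vectors, and there are countably
    many of them. *)
Lemma measurable_forall_continuous d (S : measurableType d) k (F : S -> 'cV[R]_k -> R) :
  (forall s, continuous (F s)) -> (forall z, measurable_fun setT (fun s => F s z)) ->
  measurable [set s | forall z, F s z <= 0].
Proof.
move=> cF mF.
have -> : [set s | forall z, F s z <= 0] =
    \bigcap_(q in [set: 'cV[rat]_k]) [set s | F s (map_mx ratr q) <= 0].
  apply/seteqP; split=> s /= H; first by move=> q _; exact: H.
  move=> z; rewrite leNgt; apply/negP => Fz.
  have : nbhs z [set z' | 0 < F s z'].
    have h : nbhs (F s z) [set y | 0 < y] := lt_nbhsr Fz.
    exact: (cF s z _ h).
  move=> /nbhs_ballP[e /= e0 He].
  have qP i : {q : rat | `|z i 0 - ratr q| < e}.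
    apply: cid; have zz : z i 0 - e < z i 0 + e by rewrite ltrD2l gtrN.
    have [q] := rat_in_itvoo zz; rewrite in_itv/= => /andP[q1 q2].
    by exists q; rewrite ltr_norml; apply/andP; split; lra.
  have := H (\col_i sval (qP i)) Logic.I; rewrite /= leNgt => /negP; apply.
  apply: He; split=> // i j; rewrite !mxE (ord1 j) /ball/=.
  exact: svalP (qP i).
rewrite -[X in measurable X]setCK setC_bigcap; apply: measurableC.
apply: countable_bigcupT_measurable; first exact: countableP.
move=> q; apply: measurableC; rewrite -[X in measurable X]setTI.
exact: measurable_fun_le.
Qed.

End rational_vectors.

Section split_bound.
Context {R : realType}.

Lemma continuous_sum (S : topologicalType) (I : finType) (F : I -> S -> R) :
  (forall i, continuous (F i)) -> continuous (fun x => \sum_i F i x).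
Proof.
move=> cF x; apply: cvg_big => [|i _]; last exact: cF.
exact: add_continuous.
Qed.

Lemma continuous_dotcv (S : topologicalType) m (f g : S -> 'cV[R]_m) :
  (forall i, continuous (fun s => f s i 0)) -> (forall i, continuous (fun s => g s i 0)) ->
  continuous (fun s => dotcv (f s) (g s)).
Proof.
by move=> cf cg; apply: continuous_sum => i s; apply: cvgM; [exact: cf|exact: cg].
Qed.

Lemma continuous_l2norm (S : topologicalType) m (f : S -> 'cV[R]_m) :
  (forall i, continuous (fun s => f s i 0)) -> continuous (fun s => l2norm (f s)).
Proof.
move=> cf s; apply: (@continuous_comp _ _ _ (fun s => dotcv (f s) (f s)) Num.sqrt).
  exact: continuous_dotcv.
exact: sqrt_continuous.
Qed.

Lemma measurable_sqrt : measurable_fun setT (Num.sqrt : R -> R).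
Proof. by apply: continuous_measurable_fun; exact: sqrt_continuous. Qed.

Lemma measurable_dotcv d (S : measurableType d) m (f g : S -> 'cV[R]_m) :
  (forall i, measurable_fun setT (fun s => f s i 0)) ->
  (forall i, measurable_fun setT (fun s => g s i 0)) ->
  measurable_fun setT (fun s => dotcv (f s) (g s)).
Proof.
by move=> mf mg; apply: measurable_sum => i; apply: measurable_funM.
Qed.

Lemma measurable_l2norm d (S : measurableType d) m (f : S -> 'cV[R]_m) :
  (forall i, measurable_fun setT (fun s => f s i 0)) ->
  measurable_fun setT (fun s => l2norm (f s)).
Proof.
by move=> mf; apply: (measurableT_comp measurable_sqrt); exact: measurable_dotcv.
Qed.

Lemma measurable_mulmx d (S : measurableType d) m n p (A : S -> 'M[R]_(m, n)) (B : S -> 'M[R]_(n, p)) :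
  (forall i j, measurable_fun setT (fun s => A s i j)) ->
  (forall i j, measurable_fun setT (fun s => B s i j)) ->
  forall i j, measurable_fun setT (fun s => (A s *m B s) i j).
Proof.
move=> mA mB i j; under eq_fun do rewrite mxE.
by apply: measurable_sum => k; apply: measurable_funM.
Qed.

Lemma dotcvC m (u v : 'cV[R]_m) : dotcv u v = dotcv v u.
Proof. by apply: eq_bigr => i _; rewrite mulrC. Qed.

Lemma dotcv_ge0 m (u : 'cV[R]_m) : 0 <= dotcv u u.
Proof. by apply: sumr_ge0 => i _; rewrite -expr2 sqr_ge0. Qed.

Lemma l2norm_ge0 m (u : 'cV[R]_m) : 0 <= l2norm u.
Proof. exact: sqrtr_ge0. Qed.

Lemma sqr_l2norm m (u : 'cV[R]_m) : l2norm u ^+ 2 = dotcv u u.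
Proof. by rewrite sqr_sqrtr// dotcv_ge0. Qed.

(** The induction hypothesis of the bidiagonalization. The vector c stands for
    the part of the matrix that has been processed already: it enters with one
    additional unknown t, as a column adjoined to G. For c = 0, this bounds the
    operator norm of G by a + b. *)
Definition split_bound m n (a b : R) (c : 'cV[R]_m) (G : 'M[R]_(m, n)) : Prop :=
  forall (v : 'cV[R]_m) (u : 'cV[R]_n) (t : R),
    dotcv v (G *m u + t *: c) <=
    a * l2norm v * l2norm u + b * l2norm v * Num.sqrt (t ^+ 2 + dotcv u u).

Lemma measurable_split_bound d (S : measurableType d) m n a b
    (c : S -> 'cV[R]_m) (G : S -> 'M[R]_(m, n)) :
  (forall i, measurable_fun setT (fun s => c s i 0)) ->
  (forall i j, measurable_fun setT (fun s => G s i j)) ->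
  measurable [set s | split_bound a b (c s) (G s)].
Proof.
move=> mc mG.
pose v (z : 'cV[R]_(m + (n + 1))) : 'cV_m := usubmx z.
pose u (z : 'cV[R]_(m + (n + 1))) : 'cV_n := usubmx (dsubmx z).
pose t (z : 'cV[R]_(m + (n + 1))) : R := dsubmx (dsubmx z) 0 0.
pose F s z := dotcv (v z) (G s *m u z + t z *: c s) -
  (a * l2norm (v z) * l2norm (u z) + b * l2norm (v z) * Num.sqrt (t z ^+ 2 + dotcv (u z) (u z))).
have cv i : continuous (fun z => v z i 0).
  by rewrite /v; under eq_fun do rewrite mxE; exact: coord_continuous.
have cu i : continuous (fun z => u z i 0).
  by rewrite /u; under eq_fun do rewrite !mxE; exact: coord_continuous.
have ct : continuous t.
  by rewrite /t; under eq_fun do rewrite !mxE; exact: coord_continuous.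
rewrite (_ : [set s | _] = [set s | forall z, F s z <= 0]); last first.
  apply/seteqP; split=> s /= H.
    by move=> z; rewrite subr_le0; exact: H.
  move=> v0 u0 t0; have := H (col_mx v0 (col_mx u0 (const_mx t0))).
  by rewrite /F subr_le0 /v /u /t !col_mxKd !col_mxKu mxE.
apply: measurable_forall_continuous => [s|z].
  have c1 : continuous (fun z => dotcv (v z) (G s *m u z + t z *: c s)).
    apply: continuous_dotcv => // i.
    under eq_fun do rewrite 3!mxE.
    have c11 : continuous (fun z => \sum_j G s i j * u z j 0).
      by apply: continuous_sum => j z; apply: (cvgM (cvg_cst _) (cu j z)).
    by move=> z; apply: (cvgD (c11 z)); apply: (cvgM (ct z) (cvg_cst _)).
  have c2 : continuous (fun z => l2norm (v z)) by exact: continuous_l2norm.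
  have c3 : continuous (fun z => l2norm (u z)) by exact: continuous_l2norm.
  have c4 : continuous (fun z => Num.sqrt (t z ^+ 2 + dotcv (u z) (u z))).
    move=> z; apply: (@continuous_comp _ _ _ (fun z => t z ^+ 2 + dotcv (u z) (u z)) Num.sqrt).
      by apply: (cvgD (cvgM (ct z) (ct z))); exact: continuous_dotcv.
    exact: sqrt_continuous.
  move=> z; apply: (cvgB (c1 z)); apply: cvgD.
    exact: (cvgM (cvgM (cvg_cst _) (c2 z)) (c3 z)).
  exact: (cvgM (cvgM (cvg_cst _) (c2 z)) (c4 z)).
apply: measurable_funB => //.
apply: measurable_dotcv => // i.
under eq_fun do rewrite mxE [X in _ + X]mxE.
apply: measurable_funD; last exact: measurable_funM.
by apply: measurable_mulmx.
Qed.

Lemma split_bound_orthogonal m n a b (Q : 'M[R]_m) (c : 'cV[R]_m) (G : 'M[R]_(m, n)) :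
  (forall v w : 'cV[R]_m, dotcv (Q *m v) (Q *m w) = dotcv v w) ->
  split_bound a b (Q *m c) (Q *m G) -> split_bound a b c G.
Proof.
move=> dQ H v u t; rewrite -dQ mulmxDr mulmxA -scalemxAr.
by rewrite /l2norm -(dQ v v); exact: H.
Qed.

Lemma dotcv_lift m (v w : 'cV[R]_m.+1) :
  dotcv v w = v 0 0 * w 0 0 + dotcv (row' 0 v) (row' 0 w).
Proof.
rewrite /dotcv big_ord_recl; congr (_ + _).
by apply: eq_bigr => i _; rewrite !mxE.
Qed.

Lemma cauchy_schwarz2 (x y z t : R) :
  x * z + y * t <= Num.sqrt (x ^+ 2 + y ^+ 2) * Num.sqrt (z ^+ 2 + t ^+ 2).
Proof.
rewrite -sqrtrM ?addr_ge0 ?sqr_ge0//.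
apply: le_trans (ler_norm _) _; rewrite -sqrtr_sqr ler_wsqrtr//.
rewrite -subr_ge0 (_ : _ - _ = (x * t - y * z) ^+ 2) ?sqr_ge0//; ring.
Qed.

(** One step of the bidiagonalization: when c is carried by the first axis, the
    first row of [G | c] is (row 0 G, c_0). The entry c_0, at most b, goes to
    the diagonal, while the transpose of the first row of G becomes the vector
    adjoined to the transpose of the other rows. Rows and columns exchange their
    roles, and so do a and b. The terms in b are recombined by the
    Cauchy-Schwarz inequality in the plane. *)
Lemma split_bound_peel m n a b (c : 'cV[R]_m.+1) (G : 'M[R]_(m.+1, n)) :
  0 <= a -> 0 <= b -> l2norm c <= b -> (forall i, i != 0 -> c i 0 = 0) ->
  split_bound b a (row 0 G)^T (row' 0 G)^T -> split_bound a b c G.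
Proof.
move=> a0 b0 cb c0 H v u t.
have cE : `|c 0 0| <= b.
  apply: le_trans cb; rewrite /l2norm -sqrtr_sqr ler_wsqrtr// dotcv_lift -expr2.
  by rewrite lerDl dotcv_ge0.
have -> : dotcv v (G *m u + t *: c) = c 0 0 * (v 0 0 * t) +
    dotcv u ((row' 0 G)^T *m row' 0 v + v 0 0 *: (row 0 G)^T).
  rewrite dotcv_lift.
  have -> : row' 0 (G *m u + t *: c) = row' 0 G *m u.
    apply/matrixP => i j; rewrite !mxE [X in t * X](_ : _ = 0) ?mulr0 ?addr0.
      by apply: eq_bigr => k _; rewrite !mxE.
    by rewrite (ord1 j); exact: c0.
  have -> : (G *m u + t *: c) 0 0 = dotcv u (row 0 G)^T + t * c 0 0.
    rewrite !mxE; congr (_ + _).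
    by apply: eq_bigr => k _; rewrite !mxE mulrC.
  have -> : dotcv u ((row' 0 G)^T *m row' 0 v + v 0 0 *: (row 0 G)^T) =
      dotcv (row' 0 v) (row' 0 G *m u) + v 0 0 * dotcv u (row 0 G)^T.
    rewrite /dotcv; under eq_bigr do rewrite mxE mulrDr.
    rewrite big_split/=; congr (_ + _); last first.
      rewrite mulr_sumr; apply: eq_bigr => k _.
      by rewrite !mxE mulrCA.
    under eq_bigr do rewrite mxE mulr_sumr.
    rewrite exchange_big/=; apply: eq_bigr => i _.
    rewrite [X in _ = _ * X]mxE mulr_sumr; apply: eq_bigr => j _.
    by rewrite !mxE; ring.
  ring.
have := H u (row' 0 v) (v 0 0).
have -> : Num.sqrt (v 0 0 ^+ 2 + dotcv (row' 0 v) (row' 0 v)) = l2norm v.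
  by rewrite /l2norm dotcv_lift -expr2.
have h1 : c 0 0 * (v 0 0 * t) <= b * (`|v 0 0| * `|t|).
  apply: le_trans (ler_norm _) _; rewrite 2!normrM.
  by apply: ler_wpM2r => //; apply: mulr_ge0.
have h2 : `|v 0 0| * `|t| + l2norm (row' 0 v) * l2norm u <=
    l2norm v * Num.sqrt (t ^+ 2 + dotcv u u).
  apply: le_trans (cauchy_schwarz2 _ _ _ _) _.
  by rewrite !real_normK ?num_real// !sqr_l2norm /l2norm (dotcv_lift v v) -expr2.
have h3 := ler_wpM2l b0 h2.
lra.
Qed.

End split_bound.

(** * Operator norm of a Gaussian matrix *)

Lemma measurable_preimage_fam (R : realType) d (T : measurableType d) (P : probability T R) (I : finType) (X : T -> fam R I) (A : set (fam R I)) :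
  gaussian_family P X -> measurable A -> measurable (X @^-1` A).
Proof.
move=> gX mA; rewrite -[X in measurable X]setTI.
exact: (gaussian_family_measurable gX).
Qed.

Lemma measurable_merge (R : realType) (I : finType) (J : pred I) (x : fam R I) :
  measurable_fun setT (merge J x).
Proof.
apply: measurable_fam => i; rewrite /merge; case: (J i) => //.
exact: measurable_coord.
Qed.

Lemma measurable_matrix_of (R : realType) m n (i : 'I_m) (j : 'I_n) :
  measurable_fun setT (fun x : fam R ('I_m * 'I_n)%type => matrix_of x i j).
Proof.
rewrite [X in measurable_fun _ X](_ : _ = (fun x => x (i, j))); first exact: measurable_coord.
by apply/funext => x; rewrite mxE.
Qed.

Section peeling.
Context {R : realType} d (T : measurableType d) (P : probability T R).

(** The bound is asked for all families of at most n variables, because the rows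
    get shorter as the peeling goes on. *)
Definition gaussian_norm_tail (n : nat) (a p : R) : Prop :=
  forall (I : finType) (Y : T -> fam R I), (#|I| <= n)%N -> gaussian_family P Y ->
    (P [set w | (a ^+ 2 < \sum_i Y w i ^+ 2)%R] <= p%:E)%E.

Lemma gaussian_norm_tailS m n a p : (m <= n)%N ->
  gaussian_norm_tail n a p -> gaussian_norm_tail m a p.
Proof. by move=> mn H I Y /leq_trans/(_ mn); exact: H. Qed.

(** Conditioning on the coordinates in J: a bound valid for each fixed value of
    these coordinates is valid unconditionally, by [gaussian_merge] and Tonelli's
    theorem. *)
Lemma gaussian_conditional_bound (I : finType) (X : T -> fam R I) (J : pred I)
    (A : set (fam R I)) (p : R) : 0 <= p ->
  gaussian_family P X -> measurable A ->
  (forall x, (P [set w | A (merge J x (X w))] <= p%:E)%E) ->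
  (P (X @^-1` A) <= p%:E)%E.
Proof.
move=> p0 gX mA H.
rewrite (eq_gaussian_law gX (gaussian_merge J gX) mA).
have mB := measurable_preimage_fam (gaussian_merge J gX) mA.
rewrite /= /product_measure1.
apply: (@le_trans _ _ (\int[P]_w p%:E)%E); last first.
  rewrite integral_cst// [X in (_ * X)%E](_ : _ = 1%E) ?mule1//.
  exact: probability_setT.
apply: ge0_le_integral => //.
- exact: (measurable_fun_xsection P mB).
- move=> w _ /=.
  rewrite (_ : xsection _ _ = [set w' | A (merge J (X w) (X w'))]); first exact: H.
  by apply/seteqP; split=> w'; rewrite /xsection/= inE.
Qed.

Lemma measurable_sum_sqr (I : finType) n (f : 'I_n -> I) (A : set R) : measurable A ->
  measurable [set x : fam R I | A (\sum_i x (f i) ^+ 2)].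
Proof.
move=> mA; have : measurable_fun setT (fun x : fam R I => \sum_i x (f i) ^+ 2).
  by apply: measurable_sum => i; apply: measurable_funX; exact: measurable_coord.
by move=> /(_ measurableT _ mA); rewrite setTI.
Qed.

(** Induction on m + n. After a rotation of the rows that brings c to the first
    axis, either the first row has norm larger than a, which has probability at
    most pa, or the bound fails for the transpose of the other rows with the
    first row adjoined. Given the first row, the other rows are still Gaussian,
    and the induction hypothesis applies with m and n, a and b exchanged. *)
Lemma gaussian_split_bound m n a b pa pb (c : 'cV[R]_m)
    (X : T -> fam R ('I_m * 'I_n)%type) :
  0 <= a -> 0 <= b -> 0 <= pa -> 0 <= pb ->
  gaussian_norm_tail n a pa -> gaussian_norm_tail m b pb ->
  l2norm c <= b -> gaussian_family P X ->
  (P [set w | ~ split_bound a b c (matrix_of (X w))] <= (m%:R * pa + n%:R * pb)%:E)%E.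
Proof.
have [k] := ubnP (m + n)%N.
elim: k m n a b pa pb c X => // k IH [|m] n a b pa pb c X mnk a0 b0 pa0 pb0 ta tb cb gX.
  rewrite (_ : [set w | _] = set0).
    by rewrite measure0 lee_fin mul0r add0r mulr_ge0.
  rewrite -subset0 => w /=; apply => v u t.
  by rewrite /l2norm /dotcv !big_ord0 sqrtr0 !mulr0 !mul0r addr0.
have [Q [dQ gQ] Q0] := isotropic_axis P c.
have {gQ}gX' := gQ _ _ gX; set X' := (fun w ij => _) in gX'.
have X'E w : matrix_of (X' w) = Q *m matrix_of (X w) by apply/matrixP => i j; rewrite mxE.
pose c' := Q *m c.
have c'b : l2norm c' <= b by rewrite /l2norm /c' dQ.
pose r (x : fam R ('I_m.+1 * 'I_n)%type) : 'cV[R]_n := \col_j x (ord0, j).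
pose G (x : fam R ('I_m.+1 * 'I_n)%type) : 'M[R]_(n, m) := \matrix_(j, i) x (lift ord0 i, j).
(* A1: the first row is too long; A2: it is not, and the peeled matrix is bad. *)
pose A1 := [set x : fam R ('I_m.+1 * 'I_n)%type | a ^+ 2 < \sum_j x (ord0, j) ^+ 2].
pose A2 := [set x : fam R ('I_m.+1 * 'I_n)%type | ~ a ^+ 2 < \sum_j x (ord0, j) ^+ 2] `&`
   [set x | ~ split_bound b a (r x) (G x)].
have mA1 : measurable A1.
  have := measurable_sum_sqr (fun j : 'I_n => (ord0 : 'I_m.+1, j)) (measurable_itv `]a ^+ 2, +oo[).
  rewrite (_ : [set x | _] = A1)//.
  by apply/seteqP; split=> x; rewrite /A1 /= in_itv/= andbT.
have mA2 : measurable A2.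
  apply: measurableI; first by rewrite [X in measurable X](_ : _ = ~` A1)//; exact: measurableC.
  apply: measurableC; apply: measurable_split_bound.
    move=> i; rewrite [X in measurable_fun _ X](_ : _ = (fun x => x (ord0, i))).
      exact: measurable_coord.
    by apply/funext => x; rewrite mxE.
  move=> i j; rewrite [X in measurable_fun _ X](_ : _ = (fun x => x (lift ord0 j, i))).
    exact: measurable_coord.
  by apply/funext => x; rewrite mxE.
have sub : [set w | ~ split_bound a b c (matrix_of (X w))] `<=` X' @^-1` A1 `|` X' @^-1` A2.
  move=> w /= nG; have [|nA1] := pselect (A1 (X' w)); [by left|right; split=> //=].
  move=> H; apply: nG; apply: (split_bound_orthogonal dQ).
  rewrite -X'E; apply: split_bound_peel => //.
  have -> : (row 0 (matrix_of (X' w)))^T = r (X' w) by apply/matrixP => i j; rewrite !mxE.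
  by have -> : (row' 0 (matrix_of (X' w)))^T = G (X' w) by apply/matrixP => i j; rewrite !mxE.
have mXA1 := measurable_preimage_fam gX' mA1.
have mXA2 := measurable_preimage_fam gX' mA2.
have P1 : (P (X' @^-1` A1) <= pa%:E)%E.
  have rI : injective (fun j : 'I_n => (ord0 : 'I_m.+1, j)) by move=> i j [].
  apply: (ta _ _ _ (gaussian_reindex rI gX')).
  by rewrite card_ord.
have P2 : (P (X' @^-1` A2) <= (n%:R * pb + m%:R * pa)%:E)%E.
  apply: (gaussian_conditional_bound (J := [pred ij | ij.1 == ord0])) => //.
    by rewrite addr_ge0 ?mulr_ge0.
  move=> x; have [xa|xa] := ltP (a ^+ 2) (\sum_j x (ord0, j) ^+ 2).
    rewrite (_ : [set w | _] = set0).
      by rewrite measure0 lee_fin addr_ge0 ?mulr_ge0.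
    by rewrite -subset0 => w /= [+ _]; apply; rewrite /merge/=.
  pose s (ji : 'I_n * 'I_m) := (lift ord0 ji.2, ji.1).
  have sI : injective s by move=> [i j] [i' j'] /eqP; rewrite xpair_eqE => /andP[/eqP/lift_inj /= -> /eqP /= ->].
  have gY := gaussian_reindex sI gX'.
  have rb : l2norm (r x) <= a.
    rewrite -(ger0_norm a0) -sqrtr_sqr ler_wsqrtr//; apply: le_trans xa.
    by rewrite /dotcv; under eq_bigr do rewrite mxE -expr2.
  apply: le_trans (IH n m b a pb pa (r x) _ _ b0 a0 pb0 pa0 (gaussian_norm_tailS (leqnSn m) tb) ta rb gY).
    apply: le_measure; rewrite ?inE.
    - apply: (measurable_preimage_fam gX' (A := merge [pred ij | ij.1 == ord0] x @^-1` A2)).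
      by rewrite -[X in measurable X]setTI; exact: measurable_merge.
    - apply: (measurable_preimage_fam gY (A := [set y | ~ split_bound b a (r x) (matrix_of y)])).
      apply: measurableC; apply: measurable_split_bound; first by move=> i.
      exact: measurable_matrix_of.
    - move=> w /= [_]; apply: contra_not.
      have -> : r (merge [pred ij | ij.1 == ord0] x (X' w)) = r x.
        by apply/matrixP => i j; rewrite !mxE.
      suff -> : G (merge [pred ij | ij.1 == ord0] x (X' w)) = matrix_of (fun j => X' w (s j)) by [].
      by apply/matrixP => i j; rewrite !mxE.
  by rewrite addnC; move: mnk; rewrite addSn !ltnS.
apply: (@le_trans _ _ (P (X' @^-1` A1 `|` X' @^-1` A2))).
  apply: le_measure; rewrite ?inE//; last exact: measurableU.
  apply: (measurable_preimage_fam gX (A := [set y | ~ split_bound a b c (matrix_of y)])).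
  apply: measurableC; apply: measurable_split_bound; first by move=> i.
  exact: measurable_matrix_of.
apply: le_trans (measureU2 _ _ _) _ => //.
apply: le_trans (leeD P1 P2) _.
by rewrite -EFinD lee_fin -natr1; lra.
Qed.

End peeling.

(** * Elementary inequalities *)
Section inequalities.
Context {R : realType}.

Lemma ge0_is_derive_le (f df : R -> R) (a b : R) : a <= b ->
  (forall x, a <= x <= b -> is_derive x 1 f (df x)) ->
  (forall x, a <= x <= b -> 0 <= df x) -> f a <= f b.
Proof.
move=> ab fdf df0.
have [||c] := @MVT_segment R f df a b ab.
- by move=> x /subset_itv_oo_cc; rewrite in_itv/=; exact: fdf.
- apply: derivable_within_continuous => x; rewrite in_itv/= => xab.
  by apply: ex_derive; exact: fdf.
rewrite in_itv/= => cab fE; rewrite -subr_ge0 fE.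
by rewrite mulr_ge0 ?subr_ge0 ?df0.
Qed.

(** The difference vanishes at 1 and has derivative (1 - 1/y)^2 / 2. It is
    sharper than ln y <= y - 1, and gives the upper tail of chi-square variables
    with the right constant to first order. *)
Lemma ln_le_sym (y : R) : 1 <= y -> ln y <= (y - y^-1) / 2.
Proof.
move=> y1; rewrite -subr_ge0.
have -> : 0 = (1 - 1^-1) / 2 - ln 1 :> R by rewrite ln1 invr1; ring.
apply: (@ge0_is_derive_le (fun y => (y - y^-1) / 2 - ln y) (fun y => (1 - y^-1) ^+ 2 / 2)) => //.
  move=> x /andP[x1 _]; have x0 : 0 < x by exact: lt_le_trans x1.
  have xn0 : x != 0 by rewrite gt_eqF.
  have H1 := is_derive1_ln x0.
  have H2 : is_derive x 1 (fun z : R => z^-1) (- x ^- 2).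
    by have := is_deriveV (f := id) xn0 (is_derive_id x (1 : R)); rewrite /= scaler1.
  have H3 := is_deriveB (is_deriveM (is_deriveB (is_derive_id x (1:R)) H2) (is_derive_cst (2^-1 : R) x 1)) H1.
  apply: (is_derive_eq H3); rewrite /GRing.scale /= ?fctE; field.
  exact: xn0.
by move=> x _; rewrite divr_ge0// sqr_ge0.
Qed.

(** With y = 1 - z, the function ln y - (y - 1) + (1 - y)^2 / 2 vanishes at 1 and
    has derivative (1 - y)^2 / y. *)
Lemma ln_le_quadratic (z : R) : 0 <= z < 1 -> ln (1 - z) <= - z - z ^+ 2 / 2.
Proof.
move=> /andP[z0 z1]; set y := 1 - z.
have y0 : 0 < y by rewrite subr_gt0.
have y1 : y <= 1 by rewrite gerBl.
have := @ge0_is_derive_le (fun y => ln y - (y - 1) + (1 - y) ^+ 2 / 2)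
  (fun y => (1 - y) ^+ 2 / y) y 1 y1.
rewrite ln1 !subrr expr0n mul0r addr0 => H.
have : ln y - (y - 1) + (1 - y) ^+ 2 / 2 <= 0.
  apply: H => x /andP[yx _]; have x0 : 0 < x by exact: lt_le_trans yx.
    have H1 := is_derive1_ln x0.
    have H2 := is_deriveB H1 (is_deriveB (is_derive_id x (1:R)) (is_derive_cst (1 : R) x 1)).
    have H4 := is_deriveX 2 (is_deriveB (is_derive_cst (1 : R) x 1) (is_derive_id x (1:R))).
    have H3 := is_deriveD H2 (is_deriveM H4 (is_derive_cst (2^-1 : R) x 1)).
    apply: (is_derive_eq H3); rewrite /GRing.scale /= ?fctE; field.
    by rewrite gt_eqF.
  by rewrite divr_ge0 ?sqr_ge0// ltW.
by rewrite /y; set l := ln _; lra.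
Qed.

Lemma sinh_le_mul_cosh (x : R) : 0 <= x -> expR x - expR (- x) <= x * (expR x + expR (- x)).
Proof.
move=> x0; rewrite -subr_ge0.
have -> : 0 = 0 * (expR 0 + expR (- 0)) - (expR 0 - expR (- 0)) :> R by rewrite oppr0 subrr mul0r subr0.
apply: (@ge0_is_derive_le (fun x => x * (expR x + expR (- x)) - (expR x - expR (- x)))
  (fun x => x * (expR x - expR (- x)))) => //.
  move=> y _.
  have H1 := is_derive_expR y.
  have H2 : is_derive y 1 (fun y : R => expR (- y)) (- expR (- y)).
    have := is_derive1_comp (is_derive_expR (- y)) (is_deriveN (is_derive_id y (1:R))).
    by rewrite /GRing.scale/= mulrN1.
  have H3 := is_deriveB (is_deriveM (is_derive_id y (1:R)) (is_deriveD H1 H2)) (is_deriveB H1 H2).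
  by apply: (is_derive_eq H3); rewrite /GRing.scale /= ?fctE; ring.
move=> y /andP[y0 _]; rewrite mulr_ge0// subr_ge0 ler_expR.
by rewrite (le_trans _ y0)// oppr_le0.
Qed.

(** The derivative of cosh x exp(-x^2/2) is (sinh x - x cosh x) exp(-x^2/2),
    nonpositive for x >= 0. *)
Lemma cosh_le (x : R) : (expR x + expR (- x)) / 2 <= expR (x ^+ 2 / 2).
Proof.
wlog x0 : x / 0 <= x.
  move=> H; have [|x0] := leP 0 x; first exact: H.
  have := H (- x); rewrite opprK sqrrN addrC; apply.
  by rewrite oppr_ge0 ltW.
have := @ge0_is_derive_le (fun x => 1 - (expR x + expR (- x)) / 2 * expR (- (x ^+ 2 / 2)))
  (fun x => (x * (expR x + expR (- x)) - (expR x - expR (- x))) / 2 * expR (- (x ^+ 2 / 2))) 0 x x0.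
rewrite expr0n mul0r !oppr0 expR0 mulr1 divff// subrr => H.
have : 0 <= 1 - (expR x + expR (- x)) / 2 * expR (- (x ^+ 2 / 2)).
  apply: H => y.
    move=> _.
    have H1 := is_derive_expR y.
    have H2 : is_derive y 1 (fun y : R => expR (- y)) (- expR (- y)).
      have := is_derive1_comp (is_derive_expR (- y)) (is_deriveN (is_derive_id y (1:R))).
      by rewrite /GRing.scale/= mulrN1.
    have H4 : is_derive y 1 (fun y : R => expR (- (y ^+ 2 / 2))) (- y * expR (- (y ^+ 2 / 2))).
      have H5 := is_deriveN (is_deriveM (is_deriveX 2 (is_derive_id y (1:R))) (is_derive_cst (2^-1 : R) y 1)).
      have H6 : is_derive y 1 (fun y : R => - (y ^+ 2 / 2)) (- y).
        by apply: (is_derive_eq H5); rewrite /GRing.scale/= ?fctE; field.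
      have := @is_derive1_comp R expR (fun y : R => - (y ^+ 2 / 2)) y _ _ (is_derive_expR _) H6.
      by rewrite mulrC.
    have H3 := is_deriveB (is_derive_cst (1:R) y 1) (is_deriveM (is_deriveM (is_deriveD H1 H2) (is_derive_cst (2^-1 : R) y 1)) H4).
    by apply: (is_derive_eq H3); rewrite /GRing.scale /= ?fctE; field.
  move=> /andP[y0 _]; rewrite mulr_ge0 ?expR_ge0// divr_ge0// subr_ge0.
  exact: sinh_le_mul_cosh.
by rewrite [expR (- (_ / _))]expRN subr_ge0 => H1; rewrite -[leRHS]mul1r -ler_pdivrMr// expR_gt0.
Qed.

End inequalities.

(** * Exponential moments of Gaussian sums *)
Section gaussian_moments.
Context {R : realType}.
Local Notation mu := (@lebesgue_measure R).
Local Notation gamma := (normal_prob (0 : R) 1).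

(** The exponent is chosen so that the integrand times the standard normal
    density is s times the density of standard deviation s. Parametrizing by s
    instead of by the coefficient of x^2 avoids square roots. *)
Lemma normal_integral_expR_sqr (s : R) : 0 < s ->
  (\int[gamma]_x (expR ((1 - s ^- 2) / 2 * x ^+ 2))%:E = s%:E)%E.
Proof.
move=> s0; rewrite ge0_integral_normal_prob; last 2 first.
- apply/measurable_EFinP; apply: measurableT_comp => //.
  by apply: measurable_funM => //; exact: measurable_funX.
- by move=> x; rewrite lee_fin expR_ge0.
transitivity (\int[mu]_x (s%:E * (normal_pdf 0 s x)%:E))%E.
  apply: eq_integral => x _; rewrite -!EFinM; congr EFin.
  rewrite !normal_pdfE ?oner_neq0 ?gt_eqF// /normal_fun !subr0.
  have -> : normal_peak 1 = s * normal_peak s.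
    rewrite /normal_peak expr1n mul1r -mulrnAr sqrtrM ?sqr_ge0//.
    by rewrite sqrtr_sqr gtr0_norm// invfM mulrA divff ?mul1r// gt_eqF.
  rewrite mulrCA -expRD [RHS]mulrA; congr (_ * expR _).
  by rewrite expr1n -(mulr_natl (s ^+ 2)); field; rewrite gt_eqF.
rewrite ge0_integralZl//.
- by rewrite integral_normal_pdf mule1.
- by apply/measurable_EFinP; exact: measurable_normal_pdf.
- by move=> x _; rewrite lee_fin normal_pdf_ge0.
- by rewrite lee_fin ltW.
Qed.

Lemma normal_integral_expR (t : R) :
  (\int[gamma]_x (expR (t * x))%:E = (expR (t ^+ 2 / 2))%:E)%E.
Proof.
have mt : measurable_fun setT (fun x : R => t * x) by exact: measurable_funM.
rewrite ge0_integral_normal_prob; last 2 first.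
- by apply/measurable_EFinP; exact: (measurableT_comp (@measurable_expR R) mt).
- by move=> x; rewrite lee_fin expR_ge0.
transitivity (\int[mu]_x ((expR (t ^+ 2 / 2))%:E * (normal_pdf t 1 x)%:E))%E.
  apply: eq_integral => x _; rewrite -!EFinM; congr EFin.
  rewrite !normal_pdfE ?oner_neq0// /normal_fun.
  rewrite mulrCA -expRD [RHS]mulrCA -expRD; congr (_ * expR _).
  by rewrite expr1n; field.
rewrite ge0_integralZl//.
- by rewrite integral_normal_pdf mule1.
- by apply/measurable_EFinP; exact: measurable_normal_pdf.
- by move=> x _; rewrite lee_fin normal_pdf_ge0.
Qed.

Context d (T : measurableType d) (P : probability T R).

Lemma gaussian_coord_integral (I : finType) (X : T -> fam R I) i (f : R -> \bar R) :
  gaussian_family P X -> measurable_fun setT f -> (forall x, 0 <= f x)%E ->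
  (\int[P]_w f (X w i) = \int[gamma]_x f x)%E.
Proof.
move=> gX mf f0; have mXi := gX.1 i.
transitivity (\int[pushforward P (fun w => X w i : measurableTypeR R)]_x f x)%E.
  by rewrite (@ge0_integral_pushforward _ _ T (measurableTypeR R) _ (fun w => X w i) mXi P setT)//.
apply: eq_measure_integral => A mA _.
have uI : injective (fun u : unit => i) by move=> [] [].
have := (gaussian_reindex uI gX).2 (fun=> A) (fun=> mA).
rewrite big_const card_unit /= mule1 => <-.
by congr (P _); apply/seteqP; split=> w /=; [|move=> /(_ tt)].
Qed.

(** Factors depending on disjoint blocks of coordinates are independent. *)
Lemma gaussian_block_integral (I K : finType) (X : T -> fam R I) (B : K -> pred I)
    (f : K -> fam R I -> R) (c : R) :
  gaussian_family P X ->
  (forall k, measurable_fun setT (f k)) -> (forall k x, 0 <= f k x) ->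
  (forall k x y, {in B k, x =1 y} -> f k x = f k y) ->
  (forall k k' i, k != k' -> i \in B k -> i \notin B k') ->
  (forall k, \int[P]_w (f k (X w))%:E = c%:E)%E ->
  (\int[P]_w (\prod_k f k (X w))%:E = (c ^+ #|K|)%:E)%E.
Proof.
move=> gX mf f0 fB dB fc.
have mprod s : measurable_fun setT (fun x => \prod_(k <- s) f k x).
  elim: s => [|k s IH].
    rewrite [X in measurable_fun _ X](_ : _ = cst 1)//.
    by apply/funext => x; rewrite big_nil.
  rewrite [X in measurable_fun _ X](_ : _ = (fun x => f k x * \prod_(j <- s) f j x)).
    exact: measurable_funM.
  by apply/funext => x; rewrite big_cons.
suff H s : uniq s -> (\int[P]_w (\prod_(k <- s) f k (X w))%:E = (c ^+ size s)%:E)%E.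
  by rewrite H ?index_enum_uniq// -sum1_size sum1_card.
elim: s => [_|k s IH /= /andP[ks us]].
  under eq_integral do rewrite big_nil.
  rewrite integral_cst// [X in (_ * X)%E](_ : _ = 1%E) ?mule1//.
  exact: probability_setT.
under eq_integral do rewrite big_cons EFinM.
rewrite (gaussian_integral_mul (J := B k) (f := fun x => (f k x)%:E)
  (g := fun x => (\prod_(j <- s) f j x)%:E) gX).
- by rewrite fc IH// -EFinM exprS.
- exact/measurable_EFinP.
- exact/measurable_EFinP.
- by move=> x; rewrite lee_fin.
- by move=> x; rewrite lee_fin prodr_ge0.
- by move=> x y xy; rewrite (fB k x y).
- move=> x y xy; congr EFin; apply: eq_big_seq => j js; apply: fB => i iB; apply: xy.
  rewrite inE; apply: dB iB; apply: contra ks => /eqP <-//.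
Qed.

Lemma gaussian_sum_sqr_integral (I : finType) (X : T -> fam R I) (s : R) : 0 < s ->
  gaussian_family P X ->
  (\int[P]_w (expR ((1 - s ^- 2) / 2 * \sum_i X w i ^+ 2))%:E = (s ^+ #|I|)%:E)%E.
Proof.
move=> s0 gX.
have mh : measurable_fun setT (fun x : R => expR ((1 - s ^- 2) / 2 * x ^+ 2)).
  apply: measurableT_comp => //.
  by apply: measurable_funM => //; exact: measurable_funX.
rewrite -(gaussian_block_integral (B := fun i => pred1 i)
  (f := fun i x => expR ((1 - s ^- 2) / 2 * x i ^+ 2)) gX).
- by apply: eq_integral => w _; rewrite mulr_sumr expR_sum.
- by move=> i; exact: (measurableT_comp mh (measurable_coord i)).
- by move=> i x; exact: expR_ge0.
- by move=> i x y xy; rewrite xy// inE.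
- by move=> i j k ij; rewrite !inE => /eqP ->.
- move=> i; rewrite (gaussian_coord_integral i (f := fun x => (expR ((1 - s ^- 2) / 2 * x ^+ 2))%:E) gX).
  + exact: normal_integral_expR_sqr.
  + exact/measurable_EFinP.
  + by move=> x; rewrite lee_fin expR_ge0.
Qed.

(** Integrating exp(l x y) over y gives exp(l^2 x^2 / 2), which is of the form
    integrated by [normal_integral_expR_sqr] with s^-2 = 1 - l^2. *)
Lemma gaussian_inner_integral (I : finType) (X : T -> fam R (bool * I)%type) (l : R) :
  l ^+ 2 < 1 -> gaussian_family P X ->
  (\int[P]_w (expR (l * \sum_i X w (true, i) * X w (false, i)))%:E =
   ((Num.sqrt (1 - l ^+ 2))^-1 ^+ #|I|)%:E)%E.
Proof.
move=> l1 gX.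
pose h (x y : R) := expR (l * (x * y)).
have mh d' (S : measurableType d') (f g : S -> R) :
    measurable_fun setT f -> measurable_fun setT g -> measurable_fun setT (fun s => h (f s) (g s)).
  move=> mf mg; apply: measurableT_comp => //.
  by apply: measurable_funM => //; exact: measurable_funM.
rewrite -(gaussian_block_integral (B := fun i => [pred p | p.2 == i])
  (f := fun i x => h (x (true, i)) (x (false, i))) gX).
- by apply: eq_integral => w _; rewrite mulr_sumr expR_sum.
- by move=> i; apply: mh; exact: measurable_coord.
- by move=> i x; exact: expR_ge0.
- by move=> i x y xy; rewrite !xy// inE/=.
- by move=> i j k ij; rewrite !inE => /eqP ->.
- move=> i.
  have bI : injective (fun b : bool => (b, i)) by move=> b b' [].
  have gY := gaussian_reindex bI gX.
  rewrite (eq_gaussian_integral (f := fun x : fam R bool => (h (x true) (x false))%:E) gY (@gaussian_pair R)).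
  + have mhh : measurable_fun setT (fun w : R * R => (h w.1 w.2)%:E).
      by apply/measurable_EFinP; apply: mh.
    rewrite (@fubini_tonelli1 _ _ _ _ R gamma gamma _ mhh); last by move=> w; rewrite lee_fin expR_ge0.
    pose s : R := (Num.sqrt (1 - l ^+ 2))^-1.
    have s0 : 0 < s by rewrite invr_gt0 sqrtr_gt0 subr_gt0.
    rewrite -(normal_integral_expR_sqr s0); apply: eq_integral => x _.
    rewrite /fubini_F/= /h; under eq_integral do rewrite mulrA.
    rewrite normal_integral_expR; congr (expR _)%:E.
    rewrite /s exprVn invrK sqr_sqrtr ?subr_ge0 ?ltW//; ring.
  + by apply/measurable_EFinP; apply: mh; exact: measurable_coord.
  + by move=> x; rewrite lee_fin expR_ge0.
Qed.

Lemma prob_ge0_le_expR (g : T -> R) : measurable_fun setT g ->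
  (P [set w | (0 <= g w)%R] <= \int[P]_w (expR (g w))%:E)%E.
Proof.
move=> mg.
have mA : measurable [set w | 0 <= g w].
  by rewrite -[X in measurable X]setTI; exact: measurable_fun_le.
rewrite -[leLHS]mul1e -[leLHS]integral_cst// integral_mkcond.
apply: ge0_le_integral => //.
- by move=> w _; rewrite patchE; case: ifP.
- exact/(measurable_restrict _ _ _).
- by apply/measurable_EFinP; exact: measurableT_comp.
- move=> w _; rewrite patchE; case: ifPn => [/set_mem/= gw|_]; rewrite lee_fin ?expR_ge0//.
  by rewrite -expR0 ler_expR.
Qed.

End gaussian_moments.

(** * Tail bounds for Gaussian vectors *)

Lemma measurable_ltr (R : realType) d (T : measurableType d) (f g : T -> R) :
  measurable_fun setT f -> measurable_fun setT g -> measurable [set w | f w < g w].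
Proof.
move=> mf mg; rewrite [X in measurable X](_ : _ = ~` [set w | g w <= f w]).
  by apply: measurableC; rewrite -[X in measurable X]setTI; exact: measurable_fun_le.
by apply/seteqP; split=> w /=; rewrite ltNge; move/negP.
Qed.

Section gaussian_tails.
Context {R : realType} d (T : measurableType d) (P : probability T R).

Lemma measurable_gaussian_sum_sqr (I : finType) (X : T -> fam R I) :
  gaussian_family P X -> measurable_fun setT (fun w => \sum_i X w i ^+ 2).
Proof. by move=> [mX _]; apply: measurable_sum => i; apply: measurable_funX. Qed.

(** Chernoff's bound with s = 1 + t / sqrt n, the optimal parameter, and
    [ln_le_sym] for n ln s. The exponent is t^2 up to a correction of relative
    order t / sqrt n, twice the exponent t^2 / 2 of the Lipschitz concentration
    bound. *)
Lemma gaussian_norm_tailP (n : nat) (t : R) : (0 < n)%N -> 0 <= t ->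
  gaussian_norm_tail P n (Num.sqrt n%:R + t)
    (expR (- (t ^+ 2 / 2 * (1 + (1 + t / Num.sqrt n%:R)^-1)))).
Proof.
move=> n0 t0 I Y In gY.
pose q : R := Num.sqrt n%:R.
have q0 : 0 < q by rewrite sqrtr_gt0 ltr0n.
have qn : q ^+ 2 = n%:R by rewrite sqr_sqrtr.
pose s := 1 + t / q.
have s1 : 1 <= s by rewrite lerDl divr_ge0// ltW.
have s0 : 0 < s by exact: lt_le_trans s1.
have mY := measurable_gaussian_sum_sqr gY.
pose l := (1 - s ^- 2) / 2.
have l0 : 0 <= l.
  by rewrite divr_ge0// subr_ge0 invf_le1 ?exprn_gt0// exprn_ege1.
pose g w := l * (\sum_i Y w i ^+ 2 - (q + t) ^+ 2).
have mg : measurable_fun setT g by apply: measurable_funM => //; exact: measurable_funB.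
have mA (r : R) : measurable [set w | r < \sum_i Y w i ^+ 2].
  exact: measurable_ltr.
have mB : measurable [set w | 0 <= g w].
  by rewrite -[X in measurable X]setTI; exact: measurable_fun_le.
apply: (@le_trans _ _ (P [set w | 0 <= g w])).
  apply: le_measure; rewrite ?inE//.
  by move=> w /= h; rewrite mulr_ge0// subr_ge0 ltW.
apply: le_trans (prob_ge0_le_expR P mg) _.
have gE w : (expR (g w))%:E = ((expR (- (l * (q + t) ^+ 2)))%:E * (expR (l * \sum_i Y w i ^+ 2))%:E)%E.
  by rewrite -EFinM -expRD /g mulrBr addrC.
under eq_integral do rewrite gE.
rewrite ge0_integralZl//; last first.
  by apply/measurable_EFinP; apply: measurableT_comp => //; exact: measurable_funM.
rewrite gaussian_sum_sqr_integral// -EFinM lee_fin.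
apply: (@le_trans _ _ (expR (- (l * (q + t) ^+ 2)) * s ^+ n)).
  by rewrite ler_wpM2l ?expR_ge0// ler_weXn2l.
rewrite -[s in s ^+ n](@lnK R s) ?posrE// -expRM_natl -expRD ler_expR.
have qt : q + t = q * s by rewrite /s mulrDr mulr1 mulrCA divff ?mulr1// gt_eqF.
have tq : t = q * (s - 1) by rewrite mulrBr -qt mulr1 addrC addKr.
have lns := ln_le_sym s1.
have := ler_wpM2l (ler0n R n) lns.
have -> : - (l * (q + t) ^+ 2) = - (n%:R * (s ^+ 2 - 1) / 2).
  by rewrite /l qt exprMn qn; field; rewrite gt_eqF.
have -> : - (t ^+ 2 / 2 * (1 + (1 + t / q)^-1)) =
    - (n%:R * (s ^+ 2 - 1) / 2) + n%:R * ((s - s^-1) / 2).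
  by rewrite -/s tq exprMn qn; field; rewrite gt_eqF.
by rewrite lerD2l.
Qed.

(** Chernoff's bound with the optimal parameter s^2 = 1 - z, and
    [ln_le_quadratic] for n ln s. *)
Lemma gaussian_norm_lower_tail (I : finType) (X : T -> fam R I) (z : R) :
  0 <= z < 1 -> gaussian_family P X ->
  (P [set w | (\sum_i X w i ^+ 2 < #|I|%:R * (1 - z))%R] <=
   (expR (- (#|I|%:R * z ^+ 2 / 4)))%:E)%E.
Proof.
move=> /andP[z0 z1] gX; set n : R := #|I|%:R.
pose s := Num.sqrt (1 - z).
have y0 : 0 < 1 - z by rewrite subr_gt0.
have s0 : 0 < s by rewrite sqrtr_gt0.
have s2 : s ^+ 2 = 1 - z by rewrite sqr_sqrtr// ltW.
pose l := (1 - s ^- 2) / 2.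
have l0 : l <= 0.
  rewrite pmulr_lle0// subr_le0 s2 invf_ge1//; first by rewrite gerBl.
have mX := measurable_gaussian_sum_sqr gX.
pose g w := l * (\sum_i X w i ^+ 2 - n * (1 - z)).
have mg : measurable_fun setT g by apply: measurable_funM => //; exact: measurable_funB.
have mA (r : R) : measurable [set w | \sum_i X w i ^+ 2 < r].
  exact: measurable_ltr.
have mB : measurable [set w | 0 <= g w].
  by rewrite -[X in measurable X]setTI; exact: measurable_fun_le.
apply: (@le_trans _ _ (P [set w | 0 <= g w])).
  apply: le_measure; rewrite ?inE//.
  by move=> w /= h; rewrite mulr_le0// subr_le0 ltW.
apply: le_trans (prob_ge0_le_expR P mg) _.
have gE w : (expR (g w))%:E = ((expR (- (l * (n * (1 - z)))))%:E * (expR (l * \sum_i X w i ^+ 2))%:E)%E.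
  by rewrite -EFinM -expRD /g mulrBr addrC.
under eq_integral do rewrite gE.
rewrite ge0_integralZl//; last first.
  by apply/measurable_EFinP; apply: measurableT_comp => //; exact: measurable_funM.
rewrite gaussian_sum_sqr_integral// -EFinM lee_fin.
rewrite -[s in s ^+ _](@lnK R s) ?posrE// -expRM_natl -expRD ler_expR -/n.
have lns : 2 * ln s <= - z - z ^+ 2 / 2.
  rewrite mulr_natl -lnXn// s2; apply: ln_le_quadratic; exact/andP.
have n0 : 0 <= n by rewrite /n.
have := ler_wpM2l n0 lns.
have -> : - (l * (n * (1 - z))) = n * (z / 2).
  by rewrite /l s2; field; rewrite gt_eqF.
by set L := ln s; lra.
Qed.

(** Chernoff's bound at both l and -l, where ln (1 - l^2)^-1 is bounded by
    l^2 / (1 - l^2). *)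
Lemma gaussian_inner_tail (I : finType) (X : T -> fam R (bool * I)%type) (l t : R) :
  0 <= l < 1 -> gaussian_family P X ->
  (P [set w | (t < `|\sum_i X w (true, i) * X w (false, i)|)%R] <=
   (2 * expR (#|I|%:R / 2 * (l ^+ 2 / (1 - l ^+ 2)) - l * t))%:E)%E.
Proof.
move=> /andP[l0 l1] gX.
pose S w := \sum_i X w (true, i) * X w (false, i).
have mS : measurable_fun setT S.
  by apply: measurable_sum => i; apply: measurable_funM; exact: gX.1.
have l21 : l ^+ 2 < 1 by rewrite expr_lt1.
have y0 : 0 < 1 - l ^+ 2 by rewrite subr_gt0.
have one (k : R) : k ^+ 2 = l ^+ 2 ->
    (P [set w | (0 <= k * S w - l * t)%R] <= (expR (#|I|%:R / 2 * (l ^+ 2 / (1 - l ^+ 2)) - l * t))%:E)%E.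
  move=> kl.
  have mg : measurable_fun setT (fun w => k * S w - l * t).
    by apply: measurable_funB => //; exact: measurable_funM.
  apply: le_trans (prob_ge0_le_expR P mg) _.
  under eq_integral do rewrite addrC expRD EFinM.
  rewrite ge0_integralZl//; last first.
    by apply/measurable_EFinP; apply: measurableT_comp => //; exact: measurable_funM.
  rewrite gaussian_inner_integral//; last by rewrite kl.
  rewrite -EFinM lee_fin kl; set s := _^-1.
  have s0 : 0 < s by rewrite invr_gt0 sqrtr_gt0.
  rewrite -[s in s ^+ _](@lnK R s) ?posrE// -expRM_natl -expRD ler_expR.
  rewrite addrC lerD2r -mulrA ler_wpM2l//.
  have : 2 * ln s <= l ^+ 2 / (1 - l ^+ 2); last lra.
  rewrite mulr_natl -lnXn// exprVn sqr_sqrtr ?(ltW y0)//.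
  rewrite [X in ln X](_ : _ = 1 + l ^+ 2 / (1 - l ^+ 2)); last by field; rewrite gt_eqF.
  apply: le_ln1Dx; apply: (@lt_le_trans _ _ 0) => //.
  by rewrite divr_ge0 ?sqr_ge0// ltW.
have m (k : R) : measurable [set w | 0 <= k * S w - l * t].
  rewrite -[X in measurable X]setTI; apply: measurable_fun_le => //.
  by apply: measurable_funB => //; exact: measurable_funM.
apply: (@le_trans _ _ (P ([set w | (0 <= l * S w - l * t)%R] `|` [set w | (0 <= (- l) * S w - l * t)%R]))).
  apply: le_measure; rewrite ?inE.
  - by apply: measurable_ltr => //; exact: measurableT_comp.
  - exact: measurableU.
  move=> w /=; rewrite -/(S w); have [Sw|Sw] := leP 0 (S w).
    by rewrite ger0_norm// => /ltW tS; left; rewrite /= -mulrBr mulr_ge0// subr_ge0.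
  rewrite ltr0_norm// => /ltW tS; right.
  by rewrite /= mulNr -mulrN -mulrBr mulr_ge0// subr_ge0.
apply: le_trans (measureU2 _ _ _) _ => //.
rewrite mulr_natl mulr2n EFinD; apply: leeD; apply: one => //.
by rewrite sqrrN.
Qed.

End gaussian_tails.

(** * Random signs *)
Section random_signs.
Context {R : realType}.

(** All coordinates with the same image under kappa share their sign; for
    entries of a matrix, kappa is the column index. *)
Definition flip (I K : finType) (kappa : I -> K) (e : {ffun K -> bool}) (x : fam R I) : fam R I :=
  fun i => (-1) ^+ e (kappa i) * x i.

Lemma measurable_flip (I K : finType) (kappa : I -> K) e : measurable_fun setT (flip kappa e).
Proof.
apply: measurable_fam => i; apply: measurable_funM => //.
exact: measurable_coord.
Qed.

Lemma gaussian_flip d (T : measurableType d) (P : probability T R) (I K : finType)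
    (kappa : I -> K) (e : {ffun K -> bool}) (X : T -> fam R I) :
  gaussian_family P X -> gaussian_family P (fun w => flip kappa e (X w)).
Proof.
move=> gX; split=> [i|B mB].
  exact: (measurableT_comp (measurable_coord i)
    (measurableT_comp (measurable_flip kappa e) (gaussian_family_measurable gX))).
pose C i := [set y : R | B i ((-1) ^+ e (kappa i) * y)].
have mN (A : set R) : measurable A -> measurable (-%R @^-1` A).
  by move=> mA; rewrite -[X in measurable X]setTI; exact: (@oppr_measurable R setT).
have CE i : C i = if e (kappa i) then -%R @^-1` B i else B i.
  by apply/seteqP; rewrite /C; case: (e _); split=> y /=; rewrite ?mulN1r ?mul1r.
have mC i : measurable (C i) by rewrite CE; case: (e _); [exact: mN|].
have := gX.2 C mC => ->; apply: eq_bigr => i _.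
by rewrite CE; case: (e _) => //; exact: normal_probN.
Qed.

(** Randomization: for every choice of signs the flipped family has the same law,
    so P(X in B) is the mean over the signs of the probabilities of the flipped
    events. Exchanging the mean and the integral, it is enough to count, for
    each fixed x, the signs that send x to B. *)
Lemma random_sign_bound d (T : measurableType d) (P : probability T R) (I K : finType)
    (kappa : I -> K) (X : T -> fam R I) (B : set (fam R I)) (p : R) :
  gaussian_family P X -> measurable B ->
  (forall x, #|[set e : {ffun K -> bool} | `[< B (flip kappa e x) >]]%SET|%:R <= (2 ^ #|K|)%:R * p) ->
  (P (X @^-1` B) <= p%:E)%E.
Proof.
move=> gX mB H.
pose F (e : {ffun K -> bool}) w : \bar R := (\1_((fun w => flip kappa e (X w)) @^-1` B) w)%:E.
have mFB e : measurable ((fun w => flip kappa e (X w)) @^-1` B).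
  exact: (measurable_preimage_fam (gaussian_flip kappa e gX)).
have mF e : measurable_fun setT (F e).
  by apply/measurable_EFinP; exact: measurable_indic.
have PE : (\sum_(e : {ffun K -> bool}) \int[P]_w F e w = (2 ^ #|K|)%:R%:E * P (X @^-1` B))%E.
  rewrite (eq_bigr (fun=> P (X @^-1` B))).
    have mXB := measurable_preimage_fam gX mB.
    rewrite -(fineK (fin_num_measure P _ mXB)) sumEFin sumr_const -EFinM mulr_natl.
    by rewrite card_ffun card_bool.
  move=> e _; rewrite /F integral_indic// setIT.
  by rewrite (eq_gaussian_law gX (gaussian_flip kappa e gX) mB).
have n0 : 0 < (2 ^ #|K|)%:R :> R by rewrite ltr0n expn_gt0.
rewrite -(@lee_pmul2l _ (2 ^ #|K|)%:R%:E)// -PE -ge0_integral_sum//; last first.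
  by move=> e w _; rewrite lee_fin.
apply: (@le_trans _ _ (\int[P]_w ((2 ^ #|K|)%:R * p)%:E)%E); last first.
  rewrite integral_cst// [X in (_ * X)%E](_ : _ = 1%E) ?mule1 ?EFinM//.
  exact: probability_setT.
apply: ge0_le_integral => //.
- by move=> w _; apply: sume_ge0 => e _; rewrite lee_fin.
- exact: emeasurable_sum.
- move=> w _; rewrite /F sumEFin lee_fin.
  apply: le_trans (H (X w)); rewrite -sum1_card natr_sum [leRHS]big_mkcond/=.
  apply: ler_sum => e _; rewrite inE indicE.
  have [/set_mem/= Be|_] := boolP (w \in _); last by case: ifP.
  by rewrite asboolT.
Qed.

(** The mean of exp(s sum_k e_k a_k) over the signs is a product of hyperbolic
    cosines, at most exp(s^2 sum_k a_k^2 / 2) by [cosh_le]; then take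
    s = t / sqrt (sum_k a_k^2), with both signs. *)
Lemma rademacher_hoeffding (K : finType) (a : K -> R) (t : R) : 0 < t ->
  #|[set e : {ffun K -> bool} | t ^+ 2 * \sum_k a k ^+ 2 < (\sum_k (-1) ^+ e k * a k) ^+ 2]%SET|%:R
  <= (2 ^ #|K|)%:R * (2 * expR (- (t ^+ 2 / 2))).
Proof.
move=> t0; pose A := \sum_k a k ^+ 2.
have A0 : 0 <= A by apply: sumr_ge0 => k _; exact: sqr_ge0.
pose S (e : {ffun K -> bool}) := \sum_k (-1) ^+ e k * a k.
have [Az|Az] := eqVneq A 0.
  rewrite (_ : [set e | _]%SET = finset.set0); first by rewrite cards0 !mulr_ge0// expR_ge0.
  apply/setP => e; rewrite !inE -/A Az mulr0.
  rewrite big1 ?expr0n/= ?ltxx// => k _.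
  have /eqP := Az; rewrite psumr_eq0; last by move=> i _; exact: sqr_ge0.
  by move=> /allP/(_ k (mem_index_enum _)); rewrite sqrf_eq0 => /eqP ->; rewrite mulr0.
have Ap : 0 < A by rewrite lt_neqAle eq_sym Az.
pose q := Num.sqrt A.
have q0 : 0 < q by rewrite sqrtr_gt0.
have qA : q ^+ 2 = A by rewrite sqr_sqrtr.
pose l := t / q.
have l0 : 0 < l by rewrite divr_gt0.
have cosh (s : R) : s ^+ 2 = l ^+ 2 ->
    \sum_(e : {ffun K -> bool}) expR (s * S e) <= (2 ^ #|K|)%:R * expR (t ^+ 2 / 2).
  move=> sl.
  rewrite (eq_bigr (fun e : {ffun K -> bool} => \prod_k expR (s * ((-1) ^+ e k * a k)))); last first.
    by move=> e _; rewrite /S mulr_sumr expR_sum.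
  rewrite -(bigA_distr_bigA (fun k (b : bool) => expR (s * ((-1) ^+ b * a k)))).
  apply: (@le_trans _ _ (\prod_(k : K) (2 * expR ((s * a k) ^+ 2 / 2)))).
    apply: ler_prod => k _; rewrite big_bool/= addr_ge0 ?expR_ge0//=.
    have := cosh_le (s * a k); rewrite ler_pdivrMr// => h.
    by rewrite expr1 expr0 mul1r mulN1r mulrN addrC [leRHS]mulrC.
  rewrite big_split/= -expR_sum prodr_const natrX.
  rewrite ler_wpM2l ?exprn_ge0// ler_expR -mulr_suml.
  under eq_bigr do rewrite exprMn.
  by rewrite -mulr_sumr sl -/A /l expr_div_n qA divfK.
pose f (e : {ffun K -> bool}) := expR (l * S e - t ^+ 2) + expR (- l * S e - t ^+ 2).
apply: (@le_trans _ _ (\sum_(e : {ffun K -> bool}) f e)).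
  rewrite -sum1_card natr_sum [leLHS]big_mkcond/=; apply: ler_sum => e _.
  rewrite inE; case: ifPn => [|_]; last by rewrite addr_ge0 ?expR_ge0.
  rewrite -/A -/(S e) -qA -exprMn => h.
  have : t * q < `|S e|.
    by rewrite -(@ltr_pXn2r _ 2%N)// ?nnegrE ?mulr_ge0 ?(ltW t0) ?(ltW q0)// real_normK ?num_real.
  have tl : t ^+ 2 = l * (t * q) by rewrite /l expr2; field; rewrite gt_eqF.
  have [Se|Se] := leP 0 (S e).
    rewrite ger0_norm// => tq; rewrite -[X in X <= _]addr0 lerD ?expR_ge0//.
    by rewrite -expR0 ler_expR tl subr_ge0 ler_wpM2l// ltW.
  rewrite ltr0_norm// => tq; rewrite -[X in X <= _]add0r lerD ?expR_ge0//.
  by rewrite -expR0 ler_expR tl subr_ge0 mulNr -mulrN ler_wpM2l// ltW.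
rewrite big_split/=.
have half (s : R) : s ^+ 2 = l ^+ 2 ->
    \sum_(e : {ffun K -> bool}) expR (s * S e - t ^+ 2) <= (2 ^ #|K|)%:R * expR (- (t ^+ 2 / 2)).
  move=> sl; under eq_bigr do rewrite expRD.
  rewrite -mulr_suml; apply: le_trans (ler_wpM2r (expR_ge0 _) (cosh s sl)) _.
  by rewrite -mulrA -expRD ler_wpM2l// ler_expR; lra.
have h1 := half l erefl; have h2 := half (- l) (sqrrN l).
apply: le_trans (lerD h1 h2) _.
lra.
Qed.

End random_signs.

(** * Euclidean geometry of matrices *)
Section linear_algebra.
Context {R : realType}.

Lemma dotcvDl m (u v w : 'cV[R]_m) : dotcv (u + v) w = dotcv u w + dotcv v w.
Proof. by rewrite /dotcv -big_split; apply: eq_bigr => i _; rewrite mxE mulrDl. Qed.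

Lemma dotcvDr m (u v w : 'cV[R]_m) : dotcv w (u + v) = dotcv w u + dotcv w v.
Proof. by rewrite dotcvC dotcvDl !(dotcvC w). Qed.

Lemma dotcvZl m (a : R) (u v : 'cV[R]_m) : dotcv (a *: u) v = a * dotcv u v.
Proof. by rewrite /dotcv mulr_sumr; apply: eq_bigr => i _; rewrite mxE mulrA. Qed.

Lemma dotcvZr m (a : R) (u v : 'cV[R]_m) : dotcv u (a *: v) = a * dotcv u v.
Proof. by rewrite dotcvC dotcvZl dotcvC. Qed.

Lemma l2normZ m (a : R) (u : 'cV[R]_m) : l2norm (a *: u) = `|a| * l2norm u.
Proof. by rewrite /l2norm dotcvZl dotcvZr mulrA -expr2 sqrtrM ?sqr_ge0// sqrtr_sqr. Qed.

Lemma dotcv_cauchy m (u v : 'cV[R]_m) : dotcv u v <= l2norm u * l2norm v.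
Proof.
have [v0|v0] := eqVneq (dotcv v v) 0.
  have vi i : v i 0 = 0.
    have := v0; rewrite /dotcv => /eqP; rewrite psumr_eq0.
      by move=> /allP/(_ i (mem_index_enum _)); rewrite -expr2 sqrf_eq0 => /eqP.
    by move=> j _; rewrite -expr2 sqr_ge0.
  rewrite /dotcv big1; first by rewrite mulr_ge0 ?l2norm_ge0.
  by move=> i _; rewrite vi mulr0.
have vp : 0 < dotcv v v by rewrite lt_neqAle eq_sym v0 dotcv_ge0.
apply: le_trans (ler_norm _) _.
rewrite /l2norm -sqrtrM ?dotcv_ge0// -sqrtr_sqr ler_wsqrtr//.
have := dotcv_ge0 (dotcv v v *: u + (- dotcv u v) *: v).
rewrite !(dotcvDl, dotcvDr, dotcvZl, dotcvZr) (dotcvC v u) => H.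
have : 0 <= dotcv v v * (dotcv u u * dotcv v v - dotcv u v ^+ 2).
  by apply: le_trans H _; rewrite le_eqVlt; apply/orP; left; apply/eqP; ring.
by rewrite pmulr_rge0// subr_ge0.
Qed.

Lemma l2norm_sqr_le m (u : 'cV[R]_m) (r : R) : 0 <= r -> dotcv u u <= r ^+ 2 -> l2norm u <= r.
Proof. by move=> r0 h; rewrite -(ger0_norm r0) -sqrtr_sqr ler_wsqrtr. Qed.

Lemma l2norm_triangle m (u v : 'cV[R]_m) : l2norm (u + v) <= l2norm u + l2norm v.
Proof.
apply: l2norm_sqr_le; first by rewrite addr_ge0 ?l2norm_ge0.
rewrite !(dotcvDl, dotcvDr) (dotcvC v u) sqrrD !sqr_l2norm mulr2n.
have := dotcv_cauchy u v; lra.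
Qed.

Lemma l2norm_mulmx_frobenius m n (A : 'M[R]_(m, n)) (u : 'cV[R]_n) :
  l2norm (A *m u) <= Num.sqrt (\sum_j dotcv (col j A) (col j A)) * l2norm u.
Proof.
have F0 : 0 <= \sum_j dotcv (col j A) (col j A) by apply: sumr_ge0 => j _; exact: dotcv_ge0.
apply: l2norm_sqr_le; first by rewrite mulr_ge0 ?sqrtr_ge0 ?l2norm_ge0.
rewrite exprMn sqr_sqrtr// sqr_l2norm [X in X * _]exchange_big/= mulr_suml.
apply: ler_sum => i _; rewrite -expr2.
pose r : 'cV[R]_n := \col_j A i j.
have -> : (A *m u) i 0 = dotcv r u.
  by rewrite mxE; apply: eq_bigr => j _; rewrite mxE.
have -> : \sum_j col j A i 0 * col j A i 0 = dotcv r r.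
  by apply: eq_bigr => j _; rewrite !mxE.
rewrite -!sqr_l2norm -exprMn.
rewrite -[X in X <= _]real_normK ?num_real// ler_pXn2r ?nnegrE ?mulr_ge0 ?l2norm_ge0//.
rewrite ler_norml dotcv_cauchy andbT lerNl.
have := dotcv_cauchy (- 1 *: r) u.
by rewrite dotcvZl l2normZ normrN1 mul1r mulN1r.
Qed.

(** The supremum over the unit ball is turned into a homogeneous inequality over
    all vectors, which is a countable condition by continuity and composes well
    with products. *)
Lemma spectral_norm_le m n (A : 'M[R]_(m, n)) (K : R) : 0 <= K ->
  spectral_norm A <= K <-> forall u : 'cV[R]_n, l2norm (A *m u) <= K * l2norm u.
Proof.
move=> K0; split=> [AK u|H].
  have [u0|u0] := eqVneq (l2norm u) 0.
    by apply: le_trans (l2norm_mulmx_frobenius A u) _; rewrite u0 !mulr0.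
  have up : 0 < l2norm u by rewrite lt_neqAle eq_sym u0 l2norm_ge0.
  have : l2norm (A *m ((l2norm u)^-1 *: u)) <= K.
    apply: le_trans AK; apply: ub_le_sup.
      exists (Num.sqrt (\sum_j dotcv (col j A) (col j A))) => _ [x /= x1 <-].
      apply: le_trans (l2norm_mulmx_frobenius A x) _.
      by rewrite ler_piMr// sqrtr_ge0.
    exists ((l2norm u)^-1 *: u) => //=.
    by rewrite l2normZ ger0_norm ?invr_ge0 ?l2norm_ge0// mulVf.
  rewrite -scalemxAr l2normZ ger0_norm ?invr_ge0 ?l2norm_ge0//.
  by rewrite mulrC ler_pdivrMr.
apply: ge_sup.
  by exists (l2norm (A *m 0)); exists 0 => //=; rewrite /l2norm /dotcv big1 ?sqrtr0// => i _; rewrite mxE mul0r.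
move=> _ [x /= x1 <-]; apply: le_trans (H x) _.
by rewrite ler_piMr.
Qed.

(** Take v = G u and t = 0. *)
Lemma split_bound_spectral m n a b (G : 'M[R]_(m, n)) (u : 'cV[R]_n) :
  0 <= a -> 0 <= b -> split_bound a b 0 G -> l2norm (G *m u) <= (a + b) * l2norm u.
Proof.
move=> a0 b0 H; have := H (G *m u) u 0.
rewrite scale0r addr0 expr0n add0r -/(l2norm u) -sqr_l2norm expr2.
set g := l2norm _ => h.
have [g0|g0] := eqVneq g 0; first by rewrite g0 mulr_ge0 ?addr_ge0 ?l2norm_ge0.
have gp : 0 < g by rewrite lt_neqAle eq_sym g0 l2norm_ge0.
rewrite -(ler_pM2l gp); apply: le_trans h _.
by rewrite le_eqVlt; apply/orP; left; apply/eqP; rewrite -/(l2norm u); ring.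
Qed.

Lemma col_normalize m n (F : 'M[R]_(m, n)) j :
  col j (normalize_cols F) = (l2norm (col j F))^-1 *: col j F.
Proof. by apply/matrixP => i k; rewrite !mxE mulrC. Qed.

(** Normalizing the columns is a product with the diagonal matrix of the inverse
    column norms. Truncate these inverses at d0: the truncated part costs a
    factor d0 only. The remainder is supported on the columns of norm less than
    1/d0, of which there are at most two, and each of its columns has norm at most
    1 - d0/d1; its Frobenius norm is thus at most sqrt 2 (1 - d0/d1). *)
Lemma normalize_cols_norm m n (F : 'M[R]_(m, n)) (K d0 d1 : R) :
  0 <= K -> 0 < d0 -> d0 <= d1 ->
  (forall u : 'cV[R]_n, l2norm (F *m u) <= K * l2norm u) ->
  (forall j, d1^-1 <= l2norm (col j F)) ->
  (#|[set j | (l2norm (col j F) < d0^-1)%R]%SET| <= 2)%N ->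
  forall u, l2norm (normalize_cols F *m u) <= (K * d0 + Num.sqrt 2 * (1 - d0 / d1)) * l2norm u.
Proof.
move=> K0 d0p d01 FK rho1 bad2 u.
have d1p : 0 < d1 by exact: lt_le_trans d01.
pose rho j := l2norm (col j F).
have rhop j : 0 < rho j by apply: lt_le_trans (rho1 j); rewrite invr_gt0.
pose e j := Num.min (rho j)^-1 d0.
have e0 j : 0 <= e j by rewrite le_min invr_ge0 ltW//= ltW.
have ed j : e j <= d0 by rewrite ge_min lexx orbT.
pose E : 'M[R]_(m, n) := \matrix_(i, j) (F i j * ((rho j)^-1 - e j)).
pose v : 'cV[R]_n := \col_j (e j * u j 0).
have -> : normalize_cols F *m u = F *m v + E *m u.
  apply/matrixP => i k; rewrite !mxE (ord1 k) -big_split/=.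
  by apply: eq_bigr => j _; rewrite !mxE -/(rho j); ring.
apply: le_trans (l2norm_triangle _ _) _; rewrite mulrDl lerD//.
  apply: le_trans (FK v) _; rewrite -mulrA ler_wpM2l//.
  apply: l2norm_sqr_le; first by rewrite mulr_ge0 ?l2norm_ge0// ltW.
  rewrite exprMn sqr_l2norm /dotcv mulr_sumr; apply: ler_sum => j _.
  by rewrite !mxE mulrACA -!expr2 ler_wpM2r ?sqr_ge0// ler_pXn2r ?nnegrE ?e0 ?(ltW d0p).
apply: le_trans (l2norm_mulmx_frobenius E u) _; rewrite ler_wpM2r ?l2norm_ge0//.
have x0 : 0 <= 1 - d0 / d1 by rewrite subr_ge0 ler_pdivrMr// mul1r.
rewrite -[X in _ <= _ * X]ger0_norm// -sqrtr_sqr -sqrtrM// ler_wsqrtr//.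
apply: (@le_trans _ _ (\sum_(j in [set j | (l2norm (col j F) < d0^-1)%R]%SET) (1 - d0 / d1) ^+ 2)).
  rewrite [leRHS]big_mkcond/=; apply: ler_sum => j _.
  have -> : col j E = ((rho j)^-1 - e j) *: col j F.
    by apply/matrixP => i k; rewrite !mxE mulrC.
  rewrite dotcvZl dotcvZr -sqr_l2norm -/(rho j) inE mulrA -expr2 -exprMn mulrBl mulVf ?gt_eqF//.
  have [bad|good] := ltP (rho j) (d0^-1).
    have -> : e j = d0 by apply/min_idPr; rewrite -[d0]invrK lef_pV2 ?posrE ?invr_gt0// ltW.
    rewrite ler_pXn2r ?nnegrE//; first by rewrite lerD2l lerN2; apply: ler_wpM2l; [exact: ltW|exact: rho1].
    by rewrite subr_ge0 mulrC -ler_pdivlMr// mul1r ltW.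
  have -> : e j = (rho j)^-1 by apply/min_idPl; rewrite -[d0]invrK lef_pV2 ?posrE ?invr_gt0.
  by rewrite mulVf ?gt_eqF// subrr expr0n.
rewrite sumr_const -[leLHS]mulr_natl ler_wpM2r ?sqr_ge0//.
by rewrite (ler_nat R _ 2).
Qed.

End linear_algebra.

(** * Numerical estimates *)
Section numerics.
Context {R : realType}.

Lemma expR_quarter : expR (4^-1 : R) <= 1287 / 1000.
Proof.
have sq (x c c' : R) : 0 <= x -> x <= c -> c ^+ 2 <= c' -> x ^+ 2 <= c'.
  move=> x0 xc; apply: le_trans.
  by rewrite ler_pXn2r ?nnegrE//; exact: le_trans xc.
(* exp(-1/64) >= 63/64 bounds exp(1/64), which is then squared four times. *)
pose y : R := expR 64^-1.
have y0 : 0 <= y by exact: expR_ge0.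
have y1 : y <= 64 / 63.
  have := expR_ge1Dx (- 64^-1 : R); rewrite expRN -/y => h.
  have yp : 0 < y by exact: expR_gt0.
  have := ler_wpM2l y0 h; rewrite mulfV ?gt_eqF//; lra.
have e2 (k c c' : R) : expR k <= c -> c ^+ 2 <= c' -> expR (2 * k) <= c'.
  by move=> kc; rewrite mulr_natl mulr2n expRD -expr2; exact: sq (expR_ge0 _) kc.
have h1 := e2 _ _ (129 / 125) y1 ltac:(lra).
have h2 := e2 _ _ (131 / 123) h1 ltac:(lra).
have h3 := e2 _ _ (76 / 67) h2 ltac:(lra).
have h4 := e2 _ _ (1287 / 1000) h3 ltac:(lra).
by apply: le_trans h4; rewrite ler_expR; lra.
Qed.

Lemma ln_bootstrap (k : nat) (c n : R) : 0 < c -> expR (4^-1 : R) ^+ k <= c -> c <= n ->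
  k%:R / 4 <= ln n.
Proof.
move=> c0 kc cn; rewrite -[_ / 4]expRK ler_ln ?posrE ?expR_gt0//; last exact: lt_le_trans cn.
by rewrite expRM_natl (le_trans kc).
Qed.

Lemma expR_quarter_powers (E := expR (4^-1 : R)) :
  [/\ E ^+ 2 <= 2, E ^+ 16 <= 60, E ^+ 32 <= 3800, E ^+ 38 <= 15 * 1000 & E ^+ 39 <= 20 * 1000].
Proof.
have E0 : 0 <= E by exact: expR_ge0.
have E1 : E <= 1287 / 1000 := expR_quarter.
have mul (a b c d e : R) : 0 <= a -> 0 <= b -> a <= c -> b <= d -> c * d <= e -> a * b <= e.
  by move=> a0 b0 ac bd; apply: le_trans; exact: ler_pM.
have P k : 0 <= E ^+ k by exact: exprn_ge0.
have E2 : E ^+ 2 <= 1657 / 1000 by rewrite expr2; apply: (mul _ _ _ _ _ E0 E0 E1 E1); clear; lra.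
have E4 : E ^+ 4 <= 2746 / 1000 by rewrite (exprD _ 2 2); apply: (mul _ _ _ _ _ (P _) (P _) E2 E2); clear; lra.
have E8 : E ^+ 8 <= 7541 / 1000 by rewrite (exprD _ 4 4); apply: (mul _ _ _ _ _ (P _) (P _) E4 E4); clear; lra.
have E16 : E ^+ 16 <= 569 / 10 by rewrite (exprD _ 8 8); apply: (mul _ _ _ _ _ (P _) (P _) E8 E8); clear; lra.
have E32 : E ^+ 32 <= 3238 by rewrite (exprD _ 16 16); apply: (mul _ _ _ _ _ (P _) (P _) E16 E16); clear; lra.
have E36 : E ^+ 36 <= 9 * 1000 by rewrite (exprD _ 32 4); apply: (mul _ _ _ _ _ (P _) (P _) E32 E4); clear; lra.
have E38 : E ^+ 38 <= 15 * 1000 by rewrite (exprD _ 36 2); apply: (mul _ _ _ _ _ (P _) (P _) E36 E2); clear; lra.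
split; first by apply: le_trans E2 _; clear; lra.
- by apply: le_trans E16 _; clear; lra.
- by apply: le_trans E32 _; clear; lra.
- exact: E38.
- by rewrite (exprD _ 38 1) expr1; apply: (mul _ _ _ _ _ (P _) E0 E38 E1); clear; lra.
Qed.

(** The hypotheses give 1 + 240 L^2 <= n for L = ln n, so that every lower bound
    for L improves: 1/2, 4, 8, 38/4 and 39/4 in turn. The powers of exp(1/4)
    used at each step are bounded in [expR_quarter_powers]. *)
Lemma ln_ge_of_frame (n m : R) : 2 <= n -> 60 * ln n <= m -> m <= (n - 1) / (4 * ln n) ->
  39 / 4 <= ln n.
Proof.
move=> n2 ml mu; set L := ln n in ml mu *.
have key (k : R) : 0 < k -> k <= L -> 1 + 240 * k ^+ 2 <= n.
  move=> k0 kL; have L0 : 0 < L by exact: lt_le_trans kL.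
  have : 60 * L <= (n - 1) / (4 * L) by exact: le_trans mu.
  rewrite ler_pdivlMr ?mulr_gt0// => h.
  have : k ^+ 2 <= L ^+ 2 by rewrite ler_pXn2r ?nnegrE// ltW.
  by rewrite !expr2; clear - h; lra.
have [E2 E16 E32 E38 E39] := expR_quarter_powers.
have step (k : nat) (c l : R) : expR (4^-1 : R) ^+ k <= c -> 0 < c -> c <= n -> l = k%:R / 4 -> l <= L.
  by move=> Ec c0 cn ->; exact: (ln_bootstrap c0 Ec cn).
have L1 : 2^-1 <= L by apply: (step _ _ _ E2) => //; clear; lra.
have L2 : 4 <= L.
  have := key 2^-1 ltac:(clear; lra) L1 => h.
  by apply: (step _ _ _ E16); [clear|clear - h|clear]; lra.
have L3 : 8 <= L.
  have := key 4 ltac:(clear; lra) L2 => h.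
  by apply: (step _ _ _ E32); [clear|clear - h|clear]; lra.
have L4 : 38 / 4 <= L.
  have := key 8 ltac:(clear; lra) L3 => h.
  by apply: (step _ _ _ E38); [clear|clear - h|clear]; lra.
have := key (38 / 4) ltac:(clear; lra) L4 => h.
by apply: (step _ _ _ E39); [clear|clear - h|clear]; lra.
Qed.

Lemma sqrtr_le (x c : R) : 0 <= c -> x <= c ^+ 2 -> Num.sqrt x <= c.
Proof. by move=> c0 xc; rewrite -(ger0_norm c0) -sqrtr_sqr ler_wsqrtr. Qed.

Lemma sqrtr_ge (x c : R) : 0 <= c -> c ^+ 2 <= x -> c <= Num.sqrt x.
Proof. by move=> c0 xc; rewrite -(ger0_norm c0) -sqrtr_sqr ler_wsqrtr. Qed.

Lemma sqrt2_ge : 707 / 500 <= Num.sqrt (2 : R).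
Proof. by apply: sqrtr_ge; lra. Qed.

Lemma sqrt2_le : Num.sqrt (2 : R) <= 283 / 200.
Proof. by apply: sqrtr_le; lra. Qed.

Lemma sqrt8_ge : 707 / 250 <= Num.sqrt (8 : R).
Proof. by apply: sqrtr_ge; lra. Qed.

Lemma sqrt8_le : Num.sqrt (8 : R) <= 283 / 100.
Proof. by apply: sqrtr_le; lra. Qed.

(** With q = h/h0, the claim is that (2.91 - sqrt 2) u is at most
    (1 - q) (r + p + 2.91 u - sqrt 2 h). Since sqrt 8 - 2.31 > 2 * 0.259,
    h^2 <= (1 - 0.259 u/p)^2 h0^2 and 1 - q >= 0.259 u/p, while the other factor
    is at least (2 u - 0.415) p because r >= 2 u p and h <= p. For u >= 3.12 the
    product is at least 1.508 u, and 2.91 - sqrt 2 < 1.497. *)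
Lemma spectral_trade_off (p r u h h0 : R) :
  312 / 100 <= u -> 77 / 10 * u <= p -> 2 * u * p <= r ->
  0 < h -> 0 < h0 -> h ^+ 2 = p ^+ 2 - Num.sqrt 8 * p * u ->
  h0 ^+ 2 = p ^+ 2 - 231 / 100 * p * u ->
  (r + p + 291 / 100 * u) * h0^-1 + Num.sqrt 2 * (1 - h0^-1 / h^-1) <=
  (p + r + Num.sqrt 2 * u) / h.
Proof.
move=> u3 pu rup hp h0p hE h0E.
have u0 : 0 < u by lra.
have p0 : 0 < p by apply: lt_le_trans pu; lra.
have s2l := sqrt2_ge; have s2u := sqrt2_le; have s8 := sqrt8_ge.
set s := Num.sqrt 2 in s2l s2u *; set s' := Num.sqrt 8 in s8 hE.
pose q := h / h0.
have q0 : 0 < q by rewrite divr_gt0.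
pose de := 259 / 1000 * (u / p).
have de0 : 0 < de by apply: mulr_gt0; [lra|exact: divr_gt0].
have dep : de * p = 259 / 1000 * u.
  by rewrite /de mulrA; rewrite divfK ?gt_eqF.
have s'0 : 0 <= s' by exact: sqrtr_ge0.
have de1 : de < 1.
  by rewrite -(ltr_pM2r p0) dep mul1r; clear - u0 pu; lra.
have pu0 : 0 < p * u by exact: mulr_gt0.
have uu0 : 0 < u * u by exact: mulr_gt0.
have sub0 : 0 <= 1 - de by rewrite subr_ge0 ltW.
have hh0 : h <= (1 - de) * h0.
  rewrite -(@ler_pXn2r _ 2%N) ?nnegrE ?(ltW hp) ?mulr_ge0 ?(ltW h0p) ?sub0 //.
  rewrite exprMn hE h0E.
  have : (1 - de) ^+ 2 * (p ^+ 2 - 231 / 100 * p * u) =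
    p ^+ 2 - 231 / 100 * (p * u) - 2 * (de * p) * p + 2 * (231 / 100) * (de * p) * u
    + de ^+ 2 * h0 ^+ 2 by rewrite h0E; ring.
  rewrite dep => ->.
  have b1 : 0 <= de ^+ 2 * h0 ^+ 2 by apply: mulr_ge0; exact: sqr_ge0.
  have b2 : 707 / 250 * (p * u) <= s' * (p * u) by rewrite ler_pM2r.
  have b3 : 0 <= 2 * (231 / 100) * (259 / 1000 * u) * u by clear - uu0; lra.
  clear - b1 b2 b3 pu0; lra.
have q1 : de <= 1 - q.
  by rewrite lerBrDr -lerBrDl /q ler_pdivrMr.
have hp1 : h <= p.
  rewrite -(@ler_pXn2r _ 2%N) ?nnegrE ?(ltW hp) ?(ltW p0)// hE gerBl.
  by rewrite -mulrA; apply: mulr_ge0 => //; exact: ltW.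
rewrite invrK ler_pdivlMr//.
have -> : ((r + p + 291 / 100 * u) / h0 + s * (1 - h0^-1 * h)) * h =
    (r + p + 291 / 100 * u) * q + s * (1 - q) * h.
  by rewrite /q; ring.
have b1 : (2 * u - 83 / 200) * p <= r + p + 291 / 100 * u - s * h.
  have : s * h <= 283 / 200 * p.
    by apply: ler_pM; [exact: sqrtr_ge0|exact: ltW|exact: s2u|exact: hp1].
  clear - rup u0; lra.
have b2 : 0 <= (2 * u - 83 / 200) * p by apply: mulr_ge0; [clear - u3; lra|exact: ltW].
have key : (291 / 100 - s) * u <= (1 - q) * (r + p + 291 / 100 * u - s * h).
  apply: le_trans (ler_pM (ltW de0) b2 q1 b1).
  have -> : de * ((2 * u - 83 / 200) * p) = (de * p) * (2 * u - 83 / 200) by ring.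
  rewrite dep.
  have b3 : (291 / 100 - s) * u <= (291 / 100 - 707 / 500) * u by rewrite ler_pM2r//; clear - s2l; lra.
  have b4 : 259 / 1000 * u * (2 * (312 / 100) - 83 / 200) <= 259 / 1000 * u * (2 * u - 83 / 200).
    by clear - u0 u3; apply: ler_wpM2l; lra.
  clear - b3 b4 u0; lra.
have -> : (r + p + 291 / 100 * u) * q + s * (1 - q) * h =
   (p + r + s * u) + ((291 / 100 - s) * u - (1 - q) * (r + p + 291 / 100 * u - s * h)) by ring.
by rewrite gerDl subr_le0.
Qed.

End numerics.

(** * Bad events for a Gaussian matrix *)

Lemma measurable_inv (R : realType) : measurable_fun setT (GRing.inv : R -> R).
Proof.
rewrite -(setvU [set 0 : R]); apply/measurable_funU => //; first exact: measurableC.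
split; last exact: measurable_fun_set1.
apply: open_continuous_measurable_fun; first by apply: closed_openC; exact: closed_eq.
by move=> x; rewrite inE/= => /eqP x0; exact: inv_continuous.
Qed.

Section events.
Context {R : realType} d (T : measurableType d) (P : probability T R).

(** Measurability is bundled with the bound so that both pass to unions. *)
Definition unlikely (A : set T) (p : R) : Prop := measurable A /\ (P A <= p%:E)%E.

Lemma unlikely_set0 (p : R) : 0 <= p -> unlikely set0 p.
Proof. by move=> p0; split => //; rewrite measure0 lee_fin. Qed.

Lemma unlikelyW (A : set T) (p q : R) : p <= q -> unlikely A p -> unlikely A q.
Proof. by move=> pq [mA PA]; split => //; apply: le_trans PA _; rewrite lee_fin. Qed.

Lemma unlikelyU (A B : set T) (p q : R) :
  unlikely A p -> unlikely B q -> unlikely (A `|` B) (p + q).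
Proof.
move=> [mA PA] [mB PB]; split; first exact: measurableU.
by apply: le_trans (measureU2 _ _ _) _ => //; rewrite EFinD leeD.
Qed.

Lemma unlikely_exists (K : finType) (A : K -> set T) (p : R) :
  (forall k, unlikely (A k) p) -> unlikely [set w | exists k, A k w] (#|K|%:R * p).
Proof.
move=> PA.
have H (s : seq K) : unlikely [set w | exists2 k, k \in s & A k w] ((size s)%:R * p).
  elim: s => [|k s IH].
    rewrite (_ : [set w | _] = set0); first by apply: unlikely_set0; rewrite mul0r.
    by rewrite -subset0 => w [].
  rewrite (_ : [set w | _] = A k `|` [set w | exists2 k, k \in s & A k w]); last first.
    apply/seteqP; split=> w /=.
      by move=> [j]; rewrite inE => /orP[/eqP -> Aw|js Aw]; [left|right; exists j].
    by move=> [Aw|[j js Aw]]; [exists k; rewrite ?inE ?eqxx|exists j => //; rewrite inE js orbT].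
  by rewrite /= -nat1r mulrDl mul1r; exact: unlikelyU.
have := H (enum K); rewrite -cardE.
rewrite (_ : [set w | exists2 k, _ & _] = [set w | exists k, A k w])//.
apply/seteqP; split=> w /=; first by move=> [k _ Aw]; exists k.
by move=> [k Aw]; exists k => //; rewrite mem_enum.
Qed.

Context (M N : nat) (X : T -> fam R ('I_M * 'I_N)%type) (gX : gaussian_family P X).

Local Notation entry := (fam R ('I_M * 'I_N)%type).

Definition col_sqr (x : entry) (j : 'I_N) : R := \sum_i x (i, j) ^+ 2.

Lemma col_sqrE (x : entry) j : dotcv (col j (matrix_of x)) (col j (matrix_of x)) = col_sqr x j.
Proof. by apply: eq_bigr => i _; rewrite !mxE -expr2. Qed.

Lemma measurable_col_sqr j : measurable_fun setT (fun x : entry => col_sqr x j).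
Proof. by apply: measurable_sum => i; apply: measurable_funX; exact: measurable_coord. Qed.

(** The entries of k distinct columns form one Gaussian family of kM members. *)
Lemma col_sqr_lower_tail (k : nat) (f : 'I_k -> 'I_N) (z : R) : 0 <= z < 1 -> injective f ->
  (P [set w | (\sum_(l < k) col_sqr (X w) (f l) < k%:R * M%:R * (1 - z))%R]
   <= (expR (- (k%:R * M%:R * z ^+ 2 / 4)))%:E)%E.
Proof.
move=> z01 fI.
pose s (ij : 'I_M * 'I_k) := (ij.1, f ij.2).
have sI : injective s by move=> [i j] [i' j'] [-> /fI ->].
have := gaussian_norm_lower_tail z01 (gaussian_reindex sI gX).
rewrite card_prod !card_ord natrM [M%:R * _]mulrC.
rewrite (_ : [set w | _] = [set w | (\sum_(l < k) col_sqr (X w) (f l) < k%:R * M%:R * (1 - z))%R])//.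
apply/seteqP; split=> w /=; suff -> : \sum_i X w (s i) ^+ 2 = \sum_(l < k) col_sqr (X w) (f l) by [].
  by rewrite -(pair_bigA _ (fun i l => X w (i, f l) ^+ 2))/= exchange_big.
by rewrite -(pair_bigA _ (fun i l => X w (i, f l) ^+ 2))/= exchange_big.
Qed.

Definition small_col (z : R) (x : entry) (j : 'I_N) : Prop := col_sqr x j < M%:R * (1 - z).

Lemma measurable_small_col z j : measurable [set x : entry | small_col z x j].
Proof. by apply: measurable_ltr => //; exact: measurable_col_sqr. Qed.

(** Having k small columns forces the sum of their squared norms to be small, an
    event much less likely than that of one small column: the exponent is
    multiplied by k. *)
Lemma prob_small_cols (k : nat) (z : R) : (0 < k)%N -> 0 <= z < 1 ->
  unlikely [set w | exists f : {ffun 'I_k -> 'I_N}, injective f /\ forall l, small_col z (X w) (f l)]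
    ((N ^ k)%:R * expR (- (k%:R * M%:R * z ^+ 2 / 4))).
Proof.
move=> k0 z01.
pose A (f : {ffun 'I_k -> 'I_N}) := [set w | injective f /\ forall l, small_col z (X w) (f l)].
have mA f : measurable (A f).
  have [fI|fI] := pselect (injective f); last first.
    by rewrite (_ : A f = set0)//; rewrite -subset0 => w [].
  rewrite (_ : A f = X @^-1` (\bigcap_(l in [set: 'I_k]) [set x | small_col z x (f l)])).
    apply: (measurable_preimage_fam gX); apply: fin_bigcap_measurable => // l _.
    exact: measurable_small_col.
  by apply/seteqP; split=> w /=; [move=> [_ H] l _; exact: H|move=> H; split => // l; exact: H].
have := @unlikely_exists _ A (expR (- (k%:R * M%:R * z ^+ 2 / 4))).
rewrite card_ffun !card_ord; apply => f; split => //.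
have [fI|fI] := pselect (injective f); last first.
  rewrite (_ : A f = set0); first by rewrite measure0 lee_fin expR_ge0.
  by rewrite -subset0 => w [].
apply: le_trans (col_sqr_lower_tail z01 fI).
have mS : measurable_fun setT (fun w => \sum_(l < k) col_sqr (X w) (f l)).
  apply: measurable_sum => l.
  exact: (measurableT_comp (measurable_col_sqr (f l)) (gaussian_family_measurable gX)).
apply: le_measure; rewrite ?inE//; first by apply: measurable_ltr.
move=> w /= [_ H]; rewrite -mulrA.
apply: (@lt_le_trans _ _ (\sum_(l < k) M%:R * (1 - z))); last first.
  by rewrite sumr_const card_ord -[leLHS]mulr_natl.
apply: (@ltr_sum R _ _ xpredT) => [|l _]; last exact: H.
by apply/hasP; exists (Ordinal k0) => //; exact: mem_index_enum.
Qed.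

Definition col_dot (x : entry) (i j : 'I_N) : R := \sum_k x (k, i) * x (k, j).

Lemma col_dotE (x : entry) i j : dotcv (col i (matrix_of x)) (col j (matrix_of x)) = col_dot x i j.
Proof. by apply: eq_bigr => k _; rewrite !mxE. Qed.

Lemma measurable_col_dot i j : measurable_fun setT (fun x : entry => col_dot x i j).
Proof. by apply: measurable_sum => k; apply: measurable_funM; exact: measurable_coord. Qed.

Lemma prob_large_dot (l t : R) : 0 <= l < 1 ->
  unlikely [set w | exists ij : 'I_N * 'I_N, ij.1 != ij.2 /\ t < `|col_dot (X w) ij.1 ij.2|]
    ((N * N)%:R * (2 * expR (M%:R / 2 * (l ^+ 2 / (1 - l ^+ 2)) - l * t))).
Proof.
move=> l01.
pose A (ij : 'I_N * 'I_N) := [set w | ij.1 != ij.2 /\ t < `|col_dot (X w) ij.1 ij.2|].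
have mA ij : measurable (A ij).
  have [ne|ne] := boolP (ij.1 != ij.2); last first.
    by rewrite (_ : A ij = set0)//; rewrite -subset0 => w []; rewrite (negbTE ne).
  rewrite (_ : A ij = X @^-1` [set x | t < `|col_dot x ij.1 ij.2|]).
    apply: (measurable_preimage_fam gX); apply: measurable_ltr => //.
    by apply: measurableT_comp => //; exact: measurable_col_dot.
  by apply/seteqP; split=> w /=; [case|].
have := @unlikely_exists _ A (2 * expR (M%:R / 2 * (l ^+ 2 / (1 - l ^+ 2)) - l * t)).
rewrite card_prod !card_ord; apply => -[i j]; split => //.
have [ne|ne] := boolP (i != j); last first.
  rewrite (_ : A _ = set0); first by rewrite measure0 lee_fin mulr_ge0// expR_ge0.
  by rewrite -subset0 => w []; rewrite /= (negbTE ne).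
pose s (bk : bool * 'I_M) := (bk.2, if bk.1 then i else j).
have sI : injective s.
  move=> [b k] [b' k'] /eqP; rewrite xpair_eqE => /andP[/eqP /= -> ].
  by case: b; case: b' => //= /eqP ij; rewrite ?ij ?eqxx// -ij eqxx in ne.
have := gaussian_inner_tail t l01 (gaussian_reindex sI gX).
rewrite card_ord.
rewrite (_ : [set w | _] = A (i, j))//.
by apply/seteqP; split=> w /=; [|case].
Qed.

Definition unit_dot (x : entry) (i j : 'I_N) : R :=
  col_dot x i j / (Num.sqrt (col_sqr x i) * Num.sqrt (col_sqr x j)).

Lemma unit_dotE (x : entry) i j :
  dotcv (col i (normalize_cols (matrix_of x))) (col j (normalize_cols (matrix_of x))) = unit_dot x i j.
Proof.
rewrite !col_normalize dotcvZl dotcvZr col_dotE /unit_dot /l2norm !col_sqrE invfM; ring.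
Qed.

Lemma measurable_unit_dot i j : measurable_fun setT (fun x : entry => unit_dot x i j).
Proof.
apply: measurable_funM; first exact: measurable_col_dot.
apply: (measurableT_comp (@measurable_inv R)).
by apply: measurable_funM; apply: (measurableT_comp measurable_sqrt); exact: measurable_col_sqr.
Qed.

(** Normalization commutes with changes of the signs of the columns. *)
Lemma unit_dot_flip (e : {ffun 'I_N -> bool}) (x : entry) i j :
  unit_dot (flip snd e x) i j = (-1) ^+ e i * (-1) ^+ e j * unit_dot x i j.
Proof.
have sqrE k : col_sqr (flip snd e x) k = col_sqr x k.
  by apply: eq_bigr => l _; rewrite /flip exprMn sqrr_sign mul1r.
rewrite /unit_dot !sqrE mulrA; congr (_ / _).
by rewrite /col_dot mulr_sumr; apply: eq_bigr => k _; rewrite /flip/=; ring.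
Qed.

(** Up to the sign of the column i, flipping the columns turns the sum into a
    Rademacher sum in the inner products with the unit column i, and leaves the
    sum of their squares unchanged. *)
Lemma prob_large_average (t : R) : 0 < t ->
  unlikely [set w | exists i : 'I_N, t ^+ 2 * \sum_(j | j != i) unit_dot (X w) i j ^+ 2
      < (\sum_(j | j != i) unit_dot (X w) i j) ^+ 2]
    (N%:R * (2 * expR (- (t ^+ 2 / 2)))).
Proof.
move=> t0.
pose B i := [set x : entry | t ^+ 2 * \sum_(j | j != i) unit_dot x i j ^+ 2
      < (\sum_(j | j != i) unit_dot x i j) ^+ 2].
have msum i (f : 'I_N -> entry -> R) : (forall j, measurable_fun setT (f j)) ->
    measurable_fun setT (fun x => \sum_(j | j != i) f j x).
  move=> mf; rewrite (_ : (fun x => _) = (fun x => \sum_(j < N) if j != i then f j x else 0)).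
    by apply: measurable_sum => j; case: (j != i).
  by apply/funext => x; rewrite big_mkcond.
have mB i : measurable (B i).
  apply: measurable_ltr.
    apply: measurable_funM => //; apply: msum => j.
    by apply: measurable_funX; exact: measurable_unit_dot.
  by apply: measurable_funX; apply: msum => j; exact: measurable_unit_dot.
rewrite -[N in N%:R * _](card_ord N).
apply: (@unlikely_exists _ (fun i => X @^-1` B i)) => i; split.
  exact: (measurable_preimage_fam gX).
apply: (random_sign_bound (kappa := snd) gX (mB i)) => x.
pose a j := if j != i then unit_dot x i j else 0.
apply: le_trans (rademacher_hoeffding a t0).
rewrite ler_nat; apply: subset_leq_card; apply/fintype.subsetP => e.
rewrite !inE /B/=.
have -> : \sum_(j | j != i) unit_dot (flip snd e x) i j = (-1) ^+ e i * \sum_k (-1) ^+ e k * a k.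
  rewrite big_mkcond mulr_sumr; apply: eq_bigr => j _; rewrite /a unit_dot_flip.
  by case: ifP => _; rewrite ?mulr0// mulrA.
have -> : \sum_(j | j != i) unit_dot (flip snd e x) i j ^+ 2 = \sum_k a k ^+ 2.
  rewrite big_mkcond; apply: eq_bigr => j _; rewrite /a unit_dot_flip.
  by case: ifP => _; rewrite ?expr0n// exprMn exprMn !sqrr_sign !mul1r.
by rewrite exprMn sqrr_sign mul1r => h; apply: h.
Qed.

End events.

(** * The three bounds outside of the bad events *)

Lemma measurable_bigmax (R : realType) d (S : measurableType d) (I : Type) (s : seq I)
    (Q : pred I) (f : I -> S -> R) :
  (forall i, measurable_fun setT (f i)) ->
  measurable_fun setT (fun x => \big[Num.max/0]_(i <- s | Q i) f i x).
Proof.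
move=> mf; elim: s => [|i s IH].
  by rewrite (_ : (fun _ => _) = cst 0)//; apply/funext => x; rewrite big_nil.
rewrite (_ : (fun _ => _) = (fun x => if Q i then Num.max (f i x) (\big[Num.max/0]_(i <- s | Q i) f i x)
    else \big[Num.max/0]_(i <- s | Q i) f i x)).
  by case: (Q i) => //; exact: measurable_maxr.
by apply/funext => x; rewrite big_cons.
Qed.

Section frame.
Context {R : realType} (M N : nat).
Local Notation entry := (fam R ('I_M * 'I_N)%type).
Let m : R := M%:R.
Let n : R := N%:R.
Let L : R := ln n.
Let p : R := Num.sqrt m.
Let r : R := Num.sqrt n.
Let u : R := Num.sqrt L.
Context (N_gt1 : (1 < N)%N) (m_ge : 60 * L <= m) (m_le : m <= (n - 1) / (4 * L)).

Lemma L_ge : 39 / 4 <= L.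
Proof. by apply: (ln_ge_of_frame _ m_ge m_le); rewrite (ler_nat _ 2). Qed.

Let L_gt0 : 0 < L. Proof. by have := L_ge; lra. Qed.
Let m_gt0 : 0 < m.
Proof. by apply: lt_le_trans m_ge; have := L_gt0; lra. Qed.
Let n_gt0 : 0 < n. Proof. by rewrite ltr0n ltnW. Qed.
Lemma u_sqr : u ^+ 2 = L. Proof. by rewrite sqr_sqrtr// ltW// L_gt0. Qed.
Lemma p_sqr : p ^+ 2 = m. Proof. by rewrite sqr_sqrtr// ltW// m_gt0. Qed.
Let u_gt0 : 0 < u. Proof. by rewrite sqrtr_gt0 L_gt0. Qed.
Let p_gt0 : 0 < p. Proof. by rewrite sqrtr_gt0 m_gt0. Qed.
Let r_gt0 : 0 < r. Proof. by rewrite sqrtr_gt0 n_gt0. Qed.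
Lemma u_ge : 312 / 100 <= u.
Proof. by apply: sqrtr_ge; have := L_ge; lra. Qed.
Lemma p_ge : 77 / 10 * u <= p.
Proof.
apply: sqrtr_ge; first by have := u_gt0; lra.
by rewrite exprMn u_sqr; have := m_ge; have := L_gt0; lra.
Qed.

Lemma mL_le : 4 * L * m <= n - 1.
Proof. by move: m_le; rewrite ler_pdivlMr ?mulr_gt0 ?L_gt0// mulrC. Qed.

Lemma r_ge : 2 * u * p <= r.
Proof.
apply: sqrtr_ge; first by rewrite !mulr_ge0// ltW// ?u_gt0 ?p_gt0.
by rewrite !exprMn u_sqr p_sqr; have := mL_le; lra.
Qed.

Let m_le_n : m <= n.
Proof.
have := mL_le; have := L_ge; have := m_gt0 => m0 L9.
have : 1 * m <= 4 * L * m by rewrite ler_pM2r//; lra.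
lra.
Qed.

Lemma expRL (k : nat) : expR (- (k%:R * L)) = n ^- k.
Proof. by rewrite expRN expRM_natl lnK// posrE n_gt0. Qed.

(** The column thresholds are M (1 - z8) = h^2 and M (1 - zb) = h0^2. With
    z8^2 = 8 L / M one column is below the first threshold with probability
    exp(-2L); the constant 2.31 is such that three columns are below the second
    one with probability at most exp(-4L), that is 3 * 2.31^2 / 4 >= 4. *)
Let z8 : R := Num.sqrt 8 * (u / p).
Let zb : R := 231 / 100 * (u / p).

Lemma up_le : u / p <= 10 / 77.
Proof. by rewrite ler_pdivrMr ?p_gt0//; have := p_ge; lra. Qed.

Lemma up_gt0 : 0 < u / p.
Proof. by rewrite divr_gt0 ?u_gt0 ?p_gt0. Qed.

Lemma z8_lt1 : 0 <= z8 < 1.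
Proof.
apply/andP; split; first by rewrite mulr_ge0 ?sqrtr_ge0// ltW// up_gt0.
apply: (@le_lt_trans _ _ (283 / 100 * (10 / 77))); last lra.
apply: ler_pM; [exact: sqrtr_ge0|exact/ltW/up_gt0|exact: sqrt8_le|exact: up_le].
Qed.

Lemma zb_lt1 : 0 <= zb < 1.
Proof. by rewrite /zb; have := up_le; have := up_gt0; set y := u / p; lra. Qed.

Lemma m_up : m * (u / p) ^+ 2 = L.
Proof. by rewrite expr_div_n u_sqr p_sqr mulrC divfK// gt_eqF// m_gt0. Qed.

Lemma m_z8 : m * (1 - z8) = p ^+ 2 - Num.sqrt 8 * p * u.
Proof. by rewrite -p_sqr /z8; field; rewrite gt_eqF// p_gt0. Qed.

Lemma m_zb : m * (1 - zb) = p ^+ 2 - 231 / 100 * p * u.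
Proof. by rewrite -p_sqr /zb mulrBr mulr1 -[in RHS]mulrA; congr (_ - _); rewrite mulrCA; congr (_ * _); rewrite expr2 -mulrA [p * (u / p)]mulrCA divff ?mulr1// gt_eqF// p_gt0. Qed.

Let h : R := Num.sqrt (p ^+ 2 - Num.sqrt 8 * p * u).
Let h0 : R := Num.sqrt (p ^+ 2 - 231 / 100 * p * u).

Lemma h_gt0 : 0 < h.
Proof. by rewrite sqrtr_gt0 -m_z8 mulr_gt0 ?m_gt0// subr_gt0; case/andP: z8_lt1. Qed.

Lemma h0_gt0 : 0 < h0.
Proof. by rewrite sqrtr_gt0 -m_zb mulr_gt0 ?m_gt0// subr_gt0; case/andP: zb_lt1. Qed.

Lemma h_sqr : h ^+ 2 = p ^+ 2 - Num.sqrt 8 * p * u.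
Proof. by apply: sqr_sqrtr; apply: ltW; rewrite -sqrtr_gt0; exact: h_gt0. Qed.

Lemma h0_sqr : h0 ^+ 2 = p ^+ 2 - 231 / 100 * p * u.
Proof. by apply: sqr_sqrtr; apply: ltW; rewrite -sqrtr_gt0; exact: h0_gt0. Qed.

Lemma h_le_h0 : h <= h0.
Proof.
rewrite ler_wsqrtr// lerD2l lerN2 ler_pM2r ?u_gt0// ler_pM2r ?p_gt0//.
by apply: le_trans sqrt8_ge; lra.
Qed.

(** Both constants are chosen so that the tail bound [gaussian_norm_tailP] gives
    at most exp(-2L), given that u/r and u/p are small. *)
Let a : R := r + 143 / 100 * u.
Let b : R := p + 148 / 100 * u.

Section good_matrix.
Context (x : entry).
Context (no_small : ~ exists f : {ffun 'I_1 -> 'I_N}, injective f /\ forall l, small_col z8 x (f l)).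
Context (few_small : ~ exists f : {ffun 'I_3 -> 'I_N}, injective f /\ forall l, small_col zb x (f l)).
Context (small_dot : ~ exists ij : 'I_N * 'I_N, ij.1 != ij.2 /\
  Num.sqrt 15 * u * p < `|col_dot x ij.1 ij.2|).
Context (small_avg : ~ exists i : 'I_N, (2 * u) ^+ 2 * \sum_(j | j != i) unit_dot x i j ^+ 2
      < (\sum_(j | j != i) unit_dot x i j) ^+ 2).
Context (split : split_bound a b 0 (matrix_of x)).

Lemma good_col j : h <= Num.sqrt (col_sqr x j).
Proof.
rewrite ler_wsqrtr// -m_z8 leNgt; apply/negP => sj; apply: no_small.
by exists [ffun=> j]; split => [i k _|l]; [rewrite !ord1|rewrite ffunE].
Qed.

(** The square of the column bound h satisfies
    h^2 = p (p - sqrt 8 u) >= p (p - sqrt 12 u). *)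
Lemma good_dot i j : i != j -> `|unit_dot x i j| <= Num.sqrt 15 * u / (p - Num.sqrt 12 * u).
Proof.
move=> ij; have dij : `|col_dot x i j| <= Num.sqrt 15 * u * p.
  by rewrite leNgt; apply/negP => d; apply: small_dot; exists (i, j).
have p0 := p_gt0; have u0 := u_gt0; have h2 := h_gt0; have pu := p_ge.
have s12 : Num.sqrt (12 : R) <= 347 / 100 by apply: sqrtr_le; lra.
have s12p : 0 < p - Num.sqrt 12 * u.
  rewrite subr_gt0; apply: (@le_lt_trans _ _ (347 / 100 * u)); first by rewrite ler_pM2r.
  lra.
have s8 : Num.sqrt (8 : R) <= Num.sqrt 12 by rewrite ler_wsqrtr//; lra.
have ri := good_col i; have rj := good_col j.
have hh : h ^+ 2 <= Num.sqrt (col_sqr x i) * Num.sqrt (col_sqr x j).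
  by rewrite expr2; apply: ler_pM => //; exact: ltW.
have rr0 : 0 < Num.sqrt (col_sqr x i) * Num.sqrt (col_sqr x j).
  by apply: lt_le_trans hh; rewrite exprn_gt0.
rewrite /unit_dot normrM normfV (gtr0_norm rr0) ler_pdivrMr//.
apply: le_trans dij _.
rewrite [leRHS]mulrAC ler_pdivlMr// -!mulrA; apply: ler_wpM2l; first exact: sqrtr_ge0.
apply: ler_wpM2l; first exact: ltW.
apply: le_trans hh; rewrite h_sqr expr2 [p * (_ - _)]mulrBr lerD2l lerN2 -mulrA mulrCA.
by rewrite ler_pM2l// ler_pM2r.
Qed.

Lemma coherence_bound_ge0 : 0 <= Num.sqrt 15 * u / (p - Num.sqrt 12 * u).
Proof.
have s12 : Num.sqrt (12 : R) <= 347 / 100 by apply: sqrtr_le; lra.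
have u0 := u_gt0; have pu := p_ge.
have : Num.sqrt 12 * u <= 347 / 100 * u by rewrite ler_pM2r.
move=> h12; rewrite divr_ge0 ?mulr_ge0 ?sqrtr_ge0// ?(ltW u0)//; lra.
Qed.

Lemma good_worst : worst_case_coherence (normalize_cols (matrix_of x)) <=
  Num.sqrt 15 * u / (p - Num.sqrt 12 * u).
Proof.
have k0 := coherence_bound_ge0.
apply: bigmax_le => // i _; apply: bigmax_le => // j ji.
by rewrite unit_dotE; apply: good_dot; rewrite eq_sym.
Qed.

(** The sum of the squares of the coherences is at most (n - 1) k^2, k being the
    coherence bound, so the average is at most 2 u k / sqrt (n - 1), and
    4 L m <= n - 1 turns 2 u / sqrt (n - 1) into 1 / p. *)
Lemma good_average : average_coherence (normalize_cols (matrix_of x)) <=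
  Num.sqrt 15 * u / (p - Num.sqrt 12 * u) / p.
Proof.
have k0 := coherence_bound_ge0; set k := _ / _ in k0 *.
have p0 := p_gt0; have u0 := u_gt0.
have n1 : 0 < n - 1 by rewrite subr_gt0 ltr1n.
apply: bigmax_le => [|i _]; first by rewrite divr_ge0// ltW.
under eq_bigr do rewrite unit_dotE.
set S := \sum_(_ | _) _.
have S2 : S ^+ 2 <= (2 * u) ^+ 2 * ((n - 1) * k ^+ 2).
  apply: (@le_trans _ _ ((2 * u) ^+ 2 * \sum_(j | j != i) unit_dot x i j ^+ 2)).
    by rewrite leNgt; apply/negP => lt; apply: small_avg; exists i.
  apply: ler_wpM2l; first exact: sqr_ge0.
  apply: (@le_trans _ _ (\sum_(j < N | j != i) k ^+ 2)).
    apply: ler_sum => j ji; rewrite -[X in X <= _]real_normK ?num_real//.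
    by rewrite ler_pXn2r ?nnegrE// good_dot// eq_sym.
  rewrite sumr_const -[leLHS]mulr_natl ler_wpM2r ?sqr_ge0//.
  rewrite (eq_card (B := predC1 i)); last by move=> j; rewrite !inE.
  by rewrite cardC1 card_ord -subn1 natrB// ltnW.
rewrite normrM ger0_norm ?invr_ge0 ?(ltW n1)// mulrC ler_pdivrMr// mulrAC ler_pdivlMr//.
have kn0 : 0 <= k * (n - 1) by exact: mulr_ge0 (ltW n1).
have Sp0 : 0 <= `|S| * p by exact: mulr_ge0 (ltW p0).
rewrite -(@ler_pXn2r _ 2%N)//.
rewrite [leLHS]exprMn real_normK ?num_real// p_sqr.
apply: (@le_trans _ _ ((2 * u) ^+ 2 * ((n - 1) * k ^+ 2) * m)).
  by apply: ler_wpM2r => //; exact/ltW/m_gt0.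
rewrite (_ : (2 * u) ^+ 2 * _ * m = 4 * L * m * ((n - 1) * k ^+ 2)); last first.
  by rewrite -u_sqr; ring.
rewrite (_ : (k * (n - 1)) ^+ 2 = (n - 1) * ((n - 1) * k ^+ 2)); last by ring.
by apply: ler_wpM2r mL_le; rewrite mulr_ge0 ?sqr_ge0// ltW.
Qed.

(** [normalize_cols_norm] with d0 = 1/h0 and d1 = 1/h. *)
Lemma good_spectral : spectral_norm (normalize_cols (matrix_of x)) <=
  (p + r + Num.sqrt 2 * u) / h.
Proof.
have p0 := p_gt0; have u0 := u_gt0; have hp := h_gt0; have h0p := h0_gt0; have r0 := r_gt0.
have a0 : 0 <= a by rewrite /a; lra.
have b0 : 0 <= b by rewrite /b; lra.
apply/spectral_norm_le.
  by rewrite divr_ge0 ?addr_ge0 ?mulr_ge0 ?sqrtr_ge0// ltW.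
move=> v.
have ab0 : 0 <= a + b by exact: addr_ge0.
have := @normalize_cols_norm R M N (matrix_of x) (a + b) h0^-1 h^-1 ab0.
have rhoE j : l2norm (col j (matrix_of x)) = Num.sqrt (col_sqr x j) by rewrite /l2norm col_sqrE.
move=> H; apply: le_trans (H _ _ _ _ _ v) _.
- by rewrite invr_gt0.
- by rewrite lef_pV2 ?posrE// h_le_h0.
- by move=> w; apply: split_bound_spectral.
- by move=> j; rewrite invrK rhoE good_col.
- rewrite leqNgt; apply/negP => card3; apply: few_small.
  set S := [set j | _]%SET in card3.
  exists [ffun l : 'I_3 => enum_val (widen_ord card3 l)]; split.
    move=> l l'; rewrite !ffunE => /enum_val_inj [].
    by move=> ll; apply/val_inj.
  move=> l; rewrite ffunE.
  have := enum_valP (widen_ord card3 l); rewrite inE invrK rhoE => lt.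
  rewrite /small_col m_zb -h0_sqr -(@sqr_sqrtr _ (col_sqr x _)); last by apply: sumr_ge0 => i _; exact: sqr_ge0.
  by rewrite ltr_pXn2r ?nnegrE ?sqrtr_ge0// ltW.
apply: ler_wpM2r; first exact: l2norm_ge0.
have := spectral_trade_off u_ge p_ge r_ge hp h0p h_sqr h0_sqr.
by have -> : r + p + 291 / 100 * u = a + b by rewrite /a /b; field.
Qed.

End good_matrix.

(** * Probabilities of the bad events *)

Context d (T : measurableType d) (P : probability T R).
Context (X : T -> entry) (gX : gaussian_family P X).

Let M_gt0 : (0 < M)%N. Proof. by rewrite -(ltr0n R); exact: m_gt0. Qed.
Let n_ge2 : 2 <= n. Proof. by rewrite (ler_nat _ 2). Qed.

Lemma expR_le_power (k : nat) (e : R) : e <= - (k%:R * L) -> expR e <= n ^- k.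
Proof. by move=> eL; rewrite -expRL ler_expR. Qed.

Lemma power_cancel (j k : nat) : n ^+ j * n ^- (j + k) = n ^- k.
Proof. by rewrite exprD invfM mulrA divff ?mul1r// gt_eqF// exprn_gt0. Qed.

Lemma unlikely_no_small :
  unlikely P [set w | exists f : {ffun 'I_1 -> 'I_N}, injective f /\
    forall l, small_col (Num.sqrt 8 * (u / p)) (X w) (f l)] n^-1.
Proof.
apply: unlikelyW (prob_small_cols gX (ltn0Sn 0) (z8_lt1)).
rewrite -/L -/u -/m -/p natrX -[leRHS](power_cancel 1 1) ler_wpM2l ?exprn_ge0 ?(ltW n_gt0)//.
apply: expR_le_power; rewrite lerN2 !mul1r exprMn sqr_sqrtr//.
by rewrite [m * _]mulrCA m_up; have := L_gt0; lra.
Qed.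

Lemma unlikely_few_small :
  unlikely P [set w | exists f : {ffun 'I_3 -> 'I_N}, injective f /\
    forall l, small_col (231 / 100 * (u / p)) (X w) (f l)] n^-1.
Proof.
apply: unlikelyW (prob_small_cols gX (ltn0Sn 2) (zb_lt1)).
rewrite -/L -/u -/m -/p natrX -[leRHS](power_cancel 3 1) ler_wpM2l ?exprn_ge0 ?(ltW n_gt0)//.
apply: expR_le_power; rewrite lerN2.
have -> : 3%:R * m * (231 / 100 * (u / p)) ^+ 2 / 4 = 3 / 4 * (231 / 100) ^+ 2 * (m * (u / p) ^+ 2).
  by field; rewrite gt_eqF.
rewrite m_up.
rewrite [(3 + 1)%N]/=; have := L_gt0 => L0; rewrite expr2 -subr_ge0 -mulrBl; apply: mulr_ge0; last exact: ltW.
by lra.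
Qed.

(** With l = sqrt(15) u / (2 p) and t = sqrt(15) u p, the product l t is 7.5 L,
    while M/2 * l^2 / (1 - l^2) <= 2 L because l^2 <= 1/16. The exponent is thus
    at most -5 L, which leaves room for the union bound over N^2 pairs. *)
Lemma unlikely_large_dot :
  unlikely P [set w | exists ij : 'I_N * 'I_N, ij.1 != ij.2 /\
    Num.sqrt 15 * u * p < `|col_dot (X w) ij.1 ij.2|] n^-1.
Proof.
pose l := Num.sqrt 15 / 2 * (u / p).
have s15 : Num.sqrt 15 ^+ 2 = 15 :> R by rewrite sqr_sqrtr.
have up60 : (u / p) ^+ 2 <= 1 / 60.
  by rewrite -(ler_pM2l m_gt0) m_up; have := m_ge; lra.
have l2E : l ^+ 2 = 15 / 4 * (u / p) ^+ 2.
  by rewrite /l exprMn expr_div_n s15; congr (_ * _); field.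
have l2 : l ^+ 2 <= 1 / 16 by rewrite l2E; lra.
have l0 : 0 <= l by rewrite !mulr_ge0 ?sqrtr_ge0// ?invr_ge0 ltW.
have l01 : 0 <= l < 1.
  by rewrite l0 -(@expr_lt1 _ 2)//; apply: le_lt_trans l2 _; lra.
apply: unlikelyW (prob_large_dot gX _ l01).
have -> : l * (Num.sqrt 15 * u * p) = 15 / 2 * L.
  by rewrite -u_sqr -[in RHS]s15 /l; field; rewrite gt_eqF.
have ml : m / 2 * (l ^+ 2 / (1 - l ^+ 2)) <= 2 * L.
  rewrite mulrA ler_pdivrMr; last by lra.
  have -> : m / 2 * l ^+ 2 = 15 / 8 * L by rewrite l2E -m_up; field; rewrite gt_eqF.
  apply: (@le_trans _ _ (2 * L * (15 / 16))); first by lra.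
  by rewrite ler_pM2l ?mulr_gt0//; lra.
apply: (@le_trans _ _ (n ^+ 2 * (2 * n ^- 5))).
  rewrite natrM -expr2 ler_wpM2l ?sqr_ge0// ler_wpM2l//.
  by apply: expR_le_power; rewrite lerBlDr; apply: le_trans ml _; have := L_gt0; lra.
rewrite mulrCA (power_cancel 2 3) -[leRHS](power_cancel 2 1) ler_wpM2r//.
  by rewrite invr_ge0 exprn_ge0// ltW.
rewrite expr2; apply: (@le_trans _ _ (1 * n)); first by rewrite mul1r.
by rewrite ler_wpM2r ?(ltW n_gt0)// (le_trans _ n_ge2)// ler1n.
Qed.

Lemma unlikely_large_average :
  unlikely P [set w | exists i : 'I_N, (2 * u) ^+ 2 * \sum_(j | j != i) unit_dot (X w) i j ^+ 2
      < (\sum_(j | j != i) unit_dot (X w) i j) ^+ 2] (2 * n^-1).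
Proof.
have u20 : 0 < 2 * u by rewrite mulr_gt0.
apply: unlikelyW (prob_large_average gX u20).
rewrite mulrCA ler_wpM2l// -[leRHS](power_cancel 1 1) ler_wpM2l ?(ltW n_gt0)//.
by apply: expR_le_power; rewrite exprMn u_sqr; lra.
Qed.

(** Each of the at most M + N steps of the peeling fails with probability at most
    N^-2, and M <= N. *)
Lemma unlikely_large_norm :
  unlikely P [set w | ~ split_bound (r + 143 / 100 * u) (p + 148 / 100 * u) 0 (matrix_of (X w))]
    (2 * n^-1).
Proof.
have pu := p_ge; have u3 := u_ge.
have rup := r_ge; rewrite -/L -/u -/m -/p -/n -/r in pu u3 rup.
split.
  apply: measurableC; apply: (measurable_preimage_fam (A := [set x | split_bound _ _ 0 (matrix_of x)]) gX).
  apply: (@measurable_split_bound R _ _ M N _ _ (fun=> 0) (fun x => matrix_of x)) => [i|i j]; first exact: measurable_cst.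
  exact: measurable_matrix_of.
have tail (q c : R) : 0 < q -> 2 <= c ^+ 2 / 2 * (1 + (1 + c * u / q)^-1) ->
    expR (- ((c * u) ^+ 2 / 2 * (1 + (1 + c * u / q)^-1))) <= n ^- 2.
  move=> q0 c2; apply: expR_le_power; rewrite lerN2 exprMn u_sqr.
  have -> (z : R) : c ^+ 2 * L / 2 * z = c ^+ 2 / 2 * z * L by ring.
  by rewrite ler_pM2r.
have inv_ge (y x : R) : 0 <= x -> y * (1 + x) <= 1 -> y <= (1 + x)^-1.
  move=> x0 yx; have x1 : 0 < 1 + x by exact: ltr_pwDl.
  by rewrite -[leRHS]mul1r ler_pdivlMr.
have tailN : expR (- ((143 / 100 * u) ^+ 2 / 2 * (1 + (1 + 143 / 100 * u / r)^-1))) <= n ^- 2.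
  apply: tail => //.
  have : 96 / 100 <= (1 + 143 / 100 * u / r)^-1.
    apply: inv_ge; first by rewrite divr_ge0 ?mulr_ge0// ltW.
    have : 143 / 100 * u / r <= 1 / 25.
      rewrite ler_pdivrMr//; apply: (@le_trans _ _ (1 / 25 * (2 * u * p))).
        rewrite (_ : 1 / 25 * (2 * u * p) = 2 / 25 * p * u); last by field.
        by rewrite ler_pM2r//; lra.
      by rewrite ler_pM2l//; lra.
    by lra.
  by lra.
have tailM : expR (- ((148 / 100 * u) ^+ 2 / 2 * (1 + (1 + 148 / 100 * u / p)^-1))) <= n ^- 2.
  apply: tail => //.
  have : 835 / 1000 <= (1 + 148 / 100 * u / p)^-1.
    apply: inv_ge; first by rewrite divr_ge0 ?mulr_ge0// ltW.
    have : 148 / 100 * u / p <= 1925 / 10000.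
      by rewrite ler_pdivrMr//; lra.
    by lra.
  by lra.
have a0 : 0 <= r + 143 / 100 * u by have := u_gt0; have := r_gt0; lra.
have b0 : 0 <= p + 148 / 100 * u by have := u_gt0; have := p_gt0; lra.
have t0 (c : R) : 0 < c -> 0 <= c * u by move=> c0; rewrite mulr_ge0// ltW.
have := @gaussian_split_bound R d T P M N _ _ _ _ 0 X a0 b0 (expR_ge0 _) (expR_ge0 _)
  (gaussian_norm_tailP (ltnW N_gt1) (t0 _ _)) (gaussian_norm_tailP M_gt0 (t0 _ _)) _ gX.
move=> H; apply: le_trans (H _ _ _) _.
- by [].
- by [].
- by rewrite /l2norm /dotcv big1 ?sqrtr0// => i _; rewrite mxE mul0r.
rewrite lee_fin; apply: (@le_trans _ _ (n * n ^- 2 + n * n ^- 2)).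
  have mn : m <= n by exact: m_le_n.
  by apply: lerD; [apply: ler_pM (ltW m_gt0) (expR_ge0 _) mn tailN|apply: ler_wpM2l (ltW n_gt0) _ _ tailM].
by rewrite (power_cancel 1 1) mulr_natl.
Qed.

End frame.

(** * Measurability and conclusion *)
Section measurability.
Context {R : realType} (M N : nat).
Local Notation entry := (fam R ('I_M * 'I_N)%type).

Lemma measurable_worst_case_coherence :
  measurable_fun setT (fun x : entry => worst_case_coherence (normalize_cols (matrix_of x))).
Proof.
apply: measurable_bigmax => i; apply: measurable_bigmax => j.
rewrite [X in measurable_fun _ X](_ : _ = (fun x => `|unit_dot x i j|)).
  by apply: measurableT_comp => //; exact: measurable_unit_dot.
by apply/funext => x; rewrite unit_dotE.
Qed.

Lemma measurable_average_coherence :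
  measurable_fun setT (fun x : entry => average_coherence (normalize_cols (matrix_of x))).
Proof.
apply: measurable_bigmax => i.
rewrite [X in measurable_fun _ X](_ : _ = (fun x =>
    `|(N%:R - 1)^-1 * \sum_(j < N) if j != i then unit_dot x i j else 0|)).
  apply: measurableT_comp => //; apply: measurable_funM => //.
  by apply: measurable_sum => j; case: (j != i) => //; exact: measurable_unit_dot.
apply/funext => x; congr (`|_ * _|); rewrite [LHS]big_mkcond.
by apply: eq_bigr => j _; rewrite unit_dotE.
Qed.

Lemma measurable_spectral_norm_le (K : R) : 0 <= K ->
  measurable [set x : entry | spectral_norm (normalize_cols (matrix_of x)) <= K].
Proof.
move=> K0.
pose F (x : entry) (z : 'cV[R]_N) : R := l2norm (normalize_cols (matrix_of x) *m z) - K * l2norm z.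
rewrite (_ : [set x | _] = [set x | forall z, F x z <= 0]); last first.
  apply/seteqP; split=> x /=; rewrite (spectral_norm_le _ K0) => H z.
    by rewrite subr_le0.
  by rewrite -subr_le0; exact: H.
have cc j : continuous (fun z : 'cV[R]_N => z j 0) by exact: coord_continuous.
apply: measurable_forall_continuous => [x|z].
  have c1 : continuous (fun z => l2norm (normalize_cols (matrix_of x) *m z)).
    apply: continuous_l2norm => i; under eq_fun do rewrite mxE.
    apply: continuous_sum => j z.
    by apply: (cvgM (cvg_cst _) (cc j z)).
  have c2 : continuous (fun z : 'cV[R]_N => l2norm z).
    by exact: continuous_l2norm.
  by move=> z; apply: (cvgB (c1 z)); exact: (cvgM (cvg_cst _) (c2 z)).
apply: measurable_funB; last exact: measurable_cst.
apply: measurable_l2norm => i.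
apply: measurable_mulmx => [k j|k j]; last exact: measurable_cst.
rewrite [X in measurable_fun _ X](_ : _ = (fun x : entry => matrix_of x k j / l2norm (col j (matrix_of x)))).
  apply: measurable_funM; first exact: measurable_matrix_of.
  apply: (measurableT_comp (@measurable_inv R)); apply: measurable_l2norm => l.
  rewrite [X in measurable_fun _ X](_ : _ = (fun x : entry => matrix_of x l j)).
    exact: measurable_matrix_of.
  by apply/funext => x; rewrite mxE.
by apply/funext => x; rewrite mxE.
Qed.

End measurability.

Lemma gaussian_family_independent (R : realType) (d : measure_display) (T : measurableType d)
    (P : probability T R) (I : finType) (Y : I -> {RV P >-> R}) :
  mutually_independent Y -> (forall i, standard_gaussian (Y i)) ->
  gaussian_family P (fun w => (fun i => Y i w) : fam R I).
Proof.
move=> indep gauss; split=> [i|B mB]; first exact: measurable_funPT.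
have := indep [set: I]%SET B mB.
rewrite (_ : \bigcap_(i in _) _ = [set w | forall i, B i (Y i w)]); last first.
  apply/seteqP; split=> w /= H i; last by move=> _; exact: H.
  by apply: H; rewrite /= inE.
move=> ->; apply: eq_big => [i|i _]; first by rewrite inE.
exact: (gauss i _ (mB i)).
Qed.

Theorem theorem49 (R : realType) (d : measure_display) (T : measurableType d)
    (P : probability T R) (M N : nat)
    (psi : 'I_M * 'I_N -> {RV P >-> R})
    (N_gt1 : (1 < N)%N)
    (psi_indep : mutually_independent psi)
    (psi_gauss : forall ij, standard_gaussian (psi ij))
    (M_ge : 60 * ln (N%:R : R) <= M%:R)
    (M_le : (M%:R : R) <= (N%:R - 1) / (4 * ln N%:R)) :
  let Phi (w : T) : 'M[R]_(M, N) := normalize_cols (random_matrix psi w) in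
  let logN : R := ln N%:R in
  let E := [set w : T |
    [/\ worst_case_coherence (Phi w) <=
          Num.sqrt (15 * logN) / (Num.sqrt M%:R - Num.sqrt (12 * logN)),
        average_coherence (Phi w) <=
          Num.sqrt (15 * logN) / (M%:R - Num.sqrt (12 * M%:R * logN)) &
        spectral_norm (Phi w) <=
          (Num.sqrt M%:R + Num.sqrt N%:R + Num.sqrt (2 * logN)) /
          Num.sqrt (M%:R - Num.sqrt (8 * M%:R * logN))]] in
  measurable E /\ ((1 - 11 * N%:R^-1)%:E < P E)%E.
Proof.
move=> Phi logN.
pose p : R := Num.sqrt M%:R; pose u := Num.sqrt logN.
have sL (c : R) : 0 <= c -> Num.sqrt (c * logN) = Num.sqrt c * u by move=> c0; rewrite sqrtrM.
have sML (c : R) : 0 <= c -> Num.sqrt (c * M%:R * logN) = Num.sqrt c * p * u.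
  by move=> c0; rewrite sqrtrM ?mulr_ge0// sqrtrM.
have m12 : M%:R - Num.sqrt 12 * p * u = (p - Num.sqrt 12 * u) * p.
  by rewrite mulrBl -expr2 p_sqr mulrAC.
have m8 : M%:R - Num.sqrt 8 * p * u = p ^+ 2 - Num.sqrt 8 * p * u by rewrite p_sqr.
rewrite !sML// !sL// m12 m8 invfM mulrA.
move=> E.
pose X (w : T) : fam R ('I_M * 'I_N)%type := fun ij => psi ij w.
have gX : gaussian_family P X := gaussian_family_independent psi_indep psi_gauss.
have mE : measurable E.
  pose F (x : fam R ('I_M * 'I_N)%type) := normalize_cols (matrix_of x).
  have -> : E = X @^-1` ([set x | worst_case_coherence (F x) <= Num.sqrt 15 * u / (p - Num.sqrt 12 * u)] `&`
      [set x | average_coherence (F x) <= Num.sqrt 15 * u / (p - Num.sqrt 12 * u) / p] `&`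
      [set x | spectral_norm (F x) <= (p + Num.sqrt N%:R + Num.sqrt 2 * u) / Num.sqrt (p ^+ 2 - Num.sqrt 8 * p * u)]).
    by apply/seteqP; split=> w /=; [case|case=> -[]].
  apply: (measurable_preimage_fam gX).
  apply: measurableI; last first.
    by apply: measurable_spectral_norm_le; rewrite divr_ge0 ?addr_ge0 ?mulr_ge0 ?sqrtr_ge0.
  apply: measurableI; rewrite -[X in measurable X]setTI; apply: measurable_fun_le => //.
    exact: measurable_worst_case_coherence.
  exact: measurable_average_coherence.
split=> //.
have [mB PB] := unlikelyU (unlikelyU (unlikelyU (unlikelyU (unlikely_no_small N_gt1 M_ge M_le gX)
  (unlikely_few_small N_gt1 M_ge M_le gX)) (unlikely_large_dot N_gt1 M_ge M_le gX))
  (unlikely_large_average N_gt1 M_ge M_le gX)) (unlikely_large_norm N_gt1 M_ge M_le gX).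
set B := _ `|` _ in mB PB.
have EB : ~` E `<=` B.
  move=> w; apply: contra_notP => /not_orP[/not_orP[/not_orP[/not_orP[B1 B2] B3] B4] /contrapT B5].
  split.
  - by have := good_worst N_gt1 M_ge M_le B1 B3.
  - by have := good_average N_gt1 M_ge M_le B1 B3 B4.
  - by have := good_spectral N_gt1 M_ge M_le B1 B2 B5.
have : (P (~` E) <= (7 * N%:R^-1)%:E)%E.
  apply: (@le_trans _ _ (P B)); first by apply: le_measure; rewrite ?inE//; exact: measurableC.
  apply: le_trans PB _; rewrite lee_fin le_eqVlt; apply/orP; left; apply/eqP; ring.
rewrite probability_setC// -(fineK (fin_num_measure P _ mE)) -EFinB lee_fin lte_fin.
have : 0 < (N%:R : R)^-1 by rewrite invr_gt0 ltr0n ltnW.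
lra.
Qed.
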